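(* Let $G=(V,E)$ be a graph with maximum degree $\Delta$, $|V|=n$ and $|E|=m$. If $\Delta=o\big((\log n)^2/(\log\log n)^2\big)$, then the Glauber dynamics for the monomer-dimer model on $G$ with fugacity $\lambda=1$ (i.e. the uniform distribution on matchings of $G$) mixes in time $O(n^{1+o(1)}m)$ from an arbitrary initial configuration and in time $O(m^{1+o(1)})$ from a warm start.
   Context: The monomer-dimer model with fugacity $\lambda=1$ is the uniform distribution $\mu$ on matchings of $G$ (sets of pairwise disjoint edges); equivalently, the hardcore model with fugacity $1$ on the line graph $L(G)$, whose vertices are the edges of $G$, two being adjacent if they share a vertex. The Glauber dynamics picks a uniformly random edge $e\in E$ and resamples whether $e$ belongs to the matching from $\mu$ conditioned on the status of all other edges. The mixing time from initial distribution $\pi_0$ is $\min\{t\ge0:\|\pi_0P^t-\mu\|_{TV}\le 1/4\}$; ''from an arbitrary initial configuration'' means the maximum of this over point masses; a warm start is an initial distribution $\pi_0$ with $\max_x\pi_0(x)/\mu(x)$ bounded by a polynomial in $n$. Asymptotic notation is as $n\to\infty$.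
   Formalization: The warm-start bound O(m^{1+o(1)}) is proved for graphs whose n is at most polynomial in m (automatic without isolated vertices); otherwise it fails, e.g. for j disjoint edges padded with many isolated vertices, where mixing takes order j log j. *)

(* Defs.v *)
From HB Require Import structures.
From mathcomp Require Import all_boot all_order all_algebra.
From mathcomp Require Import all_classical all_reals all_analysis.

Set Implicit Arguments.
Unset Strict Implicit.
Unset Printing Implicit Defensive.

Import Order.TTheory GRing.Theory Num.Theory.
Import numFieldNormedType.Exports.

Local Open Scope ring_scope.

Record sgraph := SGraph {
  vertex : finType;
  adj : rel vertex;
  adj_sym : symmetric adj;
  adj_irr : irreflexive adj }.

Definition degree (G : sgraph) (v : vertex G) : nat := #|[set w | adj v w]|.

Definition max_degree (G : sgraph) : nat := (\max_(v : vertex G) degree v)%N.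

Definition order_of (G : sgraph) : nat := #|vertex G|.

Definition edges (G : sgraph) : {set {set vertex G}} :=
  [set [set p.1; p.2] | p in [pred p : vertex G * vertex G | adj p.1 p.2]].

Definition size_of (G : sgraph) : nat := #|edges G|.

Definition is_matching (G : sgraph) (M : {set {set vertex G}}) : bool :=
  (M \subset edges G) && finset.trivIset M.

Definition matching (G : sgraph) : finType :=
  {M : {set {set vertex G}} | is_matching M}.

Section MonomerDimer.
Variables (R : realType) (G : sgraph).
Implicit Types (pi : matching G -> R) (M N : matching G).

Definition is_distr pi : Prop :=
  (forall M, 0 <= pi M) /\ \sum_(M : matching G) pi M = 1.

(* the monomer-dimer measure with fugacity 1 *)
Definition monomer_dimer : matching G -> R := fun _ => #|matching G|%:R^-1.

Definition agree_off (e : {set vertex G}) M N : bool :=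
  val M :\ e == val N :\ e.

(* the law of N drawn from the monomer-dimer measure conditioned on
   agreeing with M off e *)
Definition resample (e : {set vertex G}) M N : R :=
  if agree_off e M N then
    monomer_dimer N / \sum_(N' | agree_off e M N') monomer_dimer N'
  else 0.

(* When G has no edge this is the zero kernel, but then there is a single
   matching and every mixing time below is 0. *)
Definition glauber M N : R :=
  (size_of G)%:R^-1 * \sum_(e in edges G) resample e M N.

Definition glauber_step pi : matching G -> R :=
  fun N => \sum_(M : matching G) pi M * glauber M N.

Definition tv_dist pi pi' : R := 2^-1 * \sum_(M : matching G) `|pi M - pi' M|.

(* +oo if the chain never gets within 1/4 of stationarity *)
Definition mixing_time pi : \bar R :=
  ereal_inf [set (t%:R)%:E | t in
    [set t : nat | tv_dist (iter t glauber_step pi) monomer_dimer <= 4^-1]]%classic.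

Definition point_mass M : matching G -> R := fun N => (N == M)%:R.

Definition worst_mixing_time : \bar R :=
  ereal_sup (range (fun M => mixing_time (point_mass M))).

End MonomerDimer.

Arguments monomer_dimer : clear implicits.
Arguments worst_mixing_time : clear implicits.

Definition warm_starts (R : realType) (G : nat -> sgraph)
    (pi : forall k, matching (G k) -> R) : Prop :=
  (forall k, is_distr (pi k)) /\
  exists p : {poly R}, forall k M,
    pi k M / monomer_dimer R (G k) M <= p.[(order_of (G k))%:R].

(* Main.v *)
Require Import Defs.
From HB Require Import structures.
From mathcomp Require Import all_boot all_order all_algebra.
From mathcomp Require Import ring lra.
From mathcomp Require Import reals.

Set Implicit Arguments.
Unset Strict Implicit.
Unset Printing Implicit Defensive.

Import Order.TTheory GRing.Theory Num.Theory.

Local Open Scope ring_scope.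

(** Reveal every edge of a uniform matching X independently with probability
    1 - t, and let V(t) be the expected variance of f(X) given the revealed set
    S.  Then V(1) = Var f, while V(t)/t tends to the Dirichlet form of the
    Glauber dynamics as t -> 0.  Given S, the rest of X is a monomer-dimer
    matching with fugacity t on the vertices that S leaves uncovered, and
    V' <= (K(t)/t) V as soon as the rows of its influence matrix
    P(e' | e) - P(e') have l1-norm at most K(t).

    Conditioning on an edge removes its two endpoints, and removing a vertex
    changes the law along a random alternating path.  Such a path stops at each
    vertex with the probability that this vertex is unmatched; in any two
    consecutive steps it stops with probability at least 1/(1 + sqrt Delta), so
    K(t) = O(sqrt Delta), and also K(t) <= 1 + 2 t Delta.  Integrating the
    second bound over [0, 1/Delta] and the first over [1/Delta, 1] gives
    relaxation time m Delta^O(sqrt Delta) = m n^o(1).  The two mixing times then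
    differ only through the logarithm of the initial chi-square distance, which
    is at most m <= n Delta = n^(1+o(1)) from a point mass and O(log n) from a
    warm start. *)

(** * Covariances and influences *)

Section Covariance.
Variables (R : realFieldType) (T : finType) (w : {set T} -> R) (J : {set T}).
Hypothesis w_ge0 : forall X, 0 <= w X.
Let Z := \sum_X w X.
Hypothesis Z_gt0 : 0 < Z.
Let b e := \sum_(X : {set T} | e \in X) w X.
Let b2 e e' := \sum_(X : {set T} | (e \in X) && (e' \in X)) w X.
Variable K : R.
Hypothesis K_gt0 : 0 < K.
Hypothesis influence : forall e, e \in J -> 0 < b e ->
  \sum_(e' in J) `|b2 e e' / b e - b e' / Z| <= K.

Let b_ge0 e : 0 <= b e. Proof. exact: sumr_ge0. Qed.

Let b2_eq0 e e' : b e = 0 -> b2 e e' = 0.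
Proof.
move=> be0; apply/eqP; rewrite eq_le sumr_ge0 // andbT -be0.
rewrite /b2 /b [leRHS](bigID (fun X : {set T} => e' \in X)) /=.
by rewrite lerDl sumr_ge0.
Qed.

(** Gershgorin's argument. Up to the factor [Z], [b2 e e' - b e * b e' / Z] is the covariance of two
    indicators. This matrix is symmetric with absolute row sums at most [K * b e], so
    [2 y y' <= y^2 + y'^2] bounds its quadratic form by a diagonal one. *)
Let covar_le (y : T -> R) :
  \sum_(e in J) \sum_(e' in J) y e * y e' * (b2 e e' - b e * b e' / Z) <=
  K * \sum_(e in J) b e * y e ^+ 2.
Proof.
set c := fun e e' => b2 e e' - b e * b e' / Z.
have c_sym e e' : c e e' = c e' e.
  rewrite /c [b e * _]mulrC; congr (_ - _).
  by apply: eq_bigl => X; rewrite andbC.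
have row e : e \in J -> \sum_(e' in J) `|c e e'| <= K * b e.
  (* [influence] speaks only of [b e > 0]; if [b e = 0], nonnegative weights make the whole row
     vanish. *)
  move=> eJ; have := b_ge0 e; rewrite le_eqVlt => /orP[/eqP be0|be0].
    rewrite -be0 mulr0 big1 // => e' _.
    by rewrite /c b2_eq0 // -be0 !mul0r subr0 normr0.
  rewrite -ler_pdivrMr // mulr_suml.
  apply: le_trans (influence eJ be0); apply: ler_sum => e' _.
  rewrite -[in leLHS](ger0_norm (ltW be0)) -normf_div.
  suff -> : c e e' / b e = b2 e e' / b e - b e' / Z by [].
  by rewrite /c; field; rewrite !gt_eqF.
have half e e' : y e * y e' * c e e' <=
    2^-1 * (y e ^+ 2 * `|c e e'|) + 2^-1 * (y e' ^+ 2 * `|c e e'|).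
  apply: le_trans (ler_norm _) _; rewrite !normrM -mulrDr -mulrDl.
  rewrite mulrA ler_wpM2r //.
  have := sqr_ge0 (`|y e| - `|y e'|).
  rewrite -(real_normK (num_real (y e))) -(real_normK (num_real (y e'))).
  by move=> ?; nra.
apply: le_trans (_ : \sum_(e in J) y e ^+ 2 * \sum_(e' in J) `|c e e'| <= _).
  apply: le_trans (_ : \sum_(e in J) \sum_(e' in J)
    (2^-1 * (y e ^+ 2 * `|c e e'|) + 2^-1 * (y e' ^+ 2 * `|c e e'|)) <= _).
    by apply: ler_sum => e _; apply: ler_sum => e' _; exact: half.
  under eq_bigr do rewrite big_split /=.
  rewrite big_split /= [X in _ + X]exchange_big /=.
  under [X in _ + X]eq_bigr do under eq_bigr do rewrite c_sym.
  rewrite -big_split /=; apply: ler_sum => e _.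
  by rewrite -!mulr_sumr; lra.
rewrite mulr_sumr; apply: ler_sum => e eJ.
by rewrite mulrA [leRHS]mulrC ler_wpM2l ?sqr_ge0 ?row.
Qed.

(* With Y the sum of the indicators of e weighted by y e, the left side S is
   the covariance of g and Y; expanding 0 <= E (K g - (Y - E Y))^2 and using
   Var Y <= K S gives S <= K E g^2. *)
Lemma projection_le (g : {set T} -> R) : \sum_X w X * g X = 0 ->
  \sum_(e in J) b e * ((\sum_(X : {set T} | e \in X) w X * g X) / b e) ^+ 2 <=
  K * \sum_X w X * g X ^+ 2.
Proof.
move=> g0.
set y := fun e => (\sum_(X : {set T} | e \in X) w X * g X) / b e.
set S := \sum_(e in J) _.
pose Y (X : {set T}) := \sum_(e in J | e \in X) y e.
pose m := (\sum_X w X * Y X) / Z.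
have swap (h : {set T} -> R) :
    \sum_X w X * h X * Y X = \sum_(e in J) y e * \sum_(X : {set T} | e \in X) w X * h X.
  under eq_bigr do rewrite /Y mulr_sumr.
  rewrite (exchange_big_dep (mem J)) /=; last by move=> ? ? _ /andP[].
  apply: eq_bigr => e eJ; rewrite mulr_sumr; apply: eq_big => X; first by rewrite eJ.
  by move=> _; ring.
have SE : \sum_X w X * g X * Y X = S.
  rewrite swap; apply: eq_bigr => e eJ; rewrite -/(y e).
  have := b_ge0 e; rewrite le_eqVlt => /orP[/eqP be0|be0].
    by rewrite /y -be0 invr0 mulr0 !mul0r.
  rewrite expr2 mulrA mulrC; congr (_ * _).
  by rewrite /y mulrCA divff ?mulr1 ?gt_eqF.
have YE : \sum_X w X * (Y X - m) ^+ 2 =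
  \sum_(e in J) \sum_(e' in J) y e * y e' * (b2 e e' - b e * b e' / Z).
  have E1 : \sum_X w X * Y X = \sum_(e in J) y e * b e.
    have := swap (fun=> 1); under eq_bigr do rewrite mulr1.
    move=> ->; apply: eq_bigr => e _; congr (_ * _).
    by apply: eq_bigr => ? _; rewrite mulr1.
  have E2 : \sum_X w X * Y X * Y X =
    \sum_(e in J) \sum_(e' in J) y e * y e' * b2 e e'.
    rewrite swap; apply: eq_bigr => e _; rewrite mulr_sumr.
    transitivity (y e * \sum_(e' in J) y e' * b2 e e'); last first.
      by rewrite mulr_sumr; apply: eq_bigr => ? _; rewrite mulrA.
    rewrite -mulr_sumr; congr (_ * _).
    under eq_bigr do rewrite /Y mulr_sumr.
    rewrite (exchange_big_dep (mem J)) /=; last by move=> ? ? _ /andP[].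
    apply: eq_bigr => e' e'J; rewrite /b2 mulr_sumr; apply: eq_big => X; first by rewrite e'J.
    by move=> _; ring.
  transitivity (\sum_X w X * Y X * Y X - (\sum_X w X * Y X) ^+ 2 / Z).
    transitivity (\sum_X w X * Y X * Y X - 2 * m * (\sum_X w X * Y X) + m ^+ 2 * Z).
      rewrite /Z !mulr_sumr -sumrN -!big_split /=; apply: eq_bigr => X _; ring.
    rewrite /m; field; exact: lt0r_neq0.
  rewrite E2 E1 expr2 !mulr_suml -sumrB; apply: eq_bigr => e _.
  rewrite mulr_sumr mulr_suml -sumrB; apply: eq_bigr => e' _.
  ring.
have := covar_le y; rewrite -YE -/S => Yle.
have : 0 <= \sum_X w X * (K * g X - (Y X - m)) ^+ 2.
  by apply: sumr_ge0 => X _; rewrite mulr_ge0 ?sqr_ge0.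
have -> : \sum_X w X * (K * g X - (Y X - m)) ^+ 2 =
   K ^+ 2 * \sum_X w X * g X ^+ 2 - 2 * K * S
   + 2 * K * m * \sum_X w X * g X + \sum_X w X * (Y X - m) ^+ 2.
  rewrite -SE !mulr_sumr -sumrN -!big_split /=; apply: eq_bigr => X _; ring.
(* Since [g] is centred, the mean [m] of [Y] drops out of the cross term. *)
rewrite g0 mulr0 addr0 => H.
have {}H : K * S <= K * (K * \sum_X w X * g X ^+ 2) by lra.
by move: H; rewrite ler_pM2l.
Qed.

End Covariance.

(** * Links of a down-closed family of sets *)

Section Complex.
Variables (R : realFieldType) (T : finType) (I : pred {set T}).
Hypothesis I_down : forall X Y : {set T}, X \subset Y -> I Y -> I X.
Implicit Types (S X : {set T}) (h : {set T} -> R) (t : R) (e : T).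

(* The law of the pinned process: X contains S and has weight t^|X \ S|. *)
Definition link_sum h t S : R :=
  \sum_(X | I X && (S \subset X)) h X * t ^+ #|X :\: S|.

Definition link_mass t S : R := link_sum (fun=> 1) t S.

Definition link_prob t S e : R :=
  link_sum (fun X => (e \in X)%:R) t S / link_mass t S.

Definition link_var h t S : R :=
  link_sum (fun X => h X ^+ 2) t S - link_sum h t S ^+ 2 / link_mass t S.

Definition link_mean h t S : R := link_sum h t S / link_mass t S.

(** A set outside a down-closed family has no superset in it. So terms with [e |: S] outside [I]
    vanish, and sums over all [e] outside [S] need no side condition. *)
Lemma link_sum_notin h t S : ~~ I S -> link_sum h t S = 0.
Proof.
move=> NIS; rewrite /link_sum big1 // => X /andP[IX SX].
by rewrite (I_down SX IX) in NIS.
Qed.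

Lemma link_mass_gt0 t S : 0 < t -> I S -> 0 < link_mass t S.
Proof.
move=> t0 IS; rewrite /link_mass /link_sum (bigD1 S) /=; last by rewrite IS subxx.
rewrite mul1r ltr_pwDl ?exprn_gt0 //.
by apply: sumr_ge0 => X _; rewrite mul1r exprn_ge0 // ltW.
Qed.

Lemma card_setDU1 S X e : e \notin S -> e \in X ->
  #|X :\: S| = #|X :\: (e |: S)|.+1.
Proof.
move=> eS eX; rewrite (cardsD1 e) !inE eS eX add1n; congr _.+1.
by apply: eq_card => x; rewrite !inE negb_or andbA.
Qed.

Lemma link_sum_mem h t S e : e \notin S ->
  link_sum (fun X => (e \in X)%:R * h X) t S = t * link_sum h t (e |: S).
Proof.
move=> eS; rewrite /link_sum mulr_sumr.
rewrite (bigID (fun X : {set T} => e \in X)) /= [X in _ + X]big1 ?addr0; last first.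
  by move=> X /andP[_ /negPf ->]; rewrite !mul0r.
apply: eq_big => [X|X /andP[_ eX]].
  by rewrite subUset sub1set andbAC -andbA.
by rewrite eX mul1r (card_setDU1 eS eX) exprS; ring.
Qed.

(** [projection_le] for the weights of the link of [S] and for [h] minus its mean there. The event
    [e \in X] has weight [t * link_mass t (e |: S)], whence [K / t] in place of [K]. *)
Lemma influence_link_var h t S (K : R) : 0 < t -> 0 < K -> I S ->
  (forall e, e \notin S -> I (e |: S) ->
     \sum_(e' in ~: S) `|link_prob t (e |: S) e' - link_prob t S e'| <= K) ->
  \sum_(e in ~: S) link_mass t (e |: S) *
     (link_mean h t (e |: S) - link_mean h t S) ^+ 2 <= K / t * link_var h t S.
Proof.
move=> t0 K0 IS infl.
pose w X := if I X && (S \subset X) then t ^+ #|X :\: S| else 0.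
have wE g : \sum_X w X * g X = link_sum g t S.
  rewrite /link_sum [RHS]big_mkcond; apply: eq_bigr => X _.
  by rewrite /w; case: ifP => _; rewrite ?mul0r // mulrC.
have wmE e g : e \notin S -> \sum_(X : {set T} | e \in X) w X * g X = t * link_sum g t (e |: S).
  move=> eS; rewrite -link_sum_mem // -wE big_mkcond; apply: eq_bigr => X _.
  by case: (e \in X); rewrite ?mul0r ?mulr0 ?mul1r.
have w_ge0 X : 0 <= w X by rewrite /w; case: ifP => // _; rewrite exprn_ge0 ?ltW.
have ZE : \sum_X w X = link_mass t S.
  by rewrite /link_mass -wE; apply: eq_bigr => X _; rewrite mulr1.
have Z0 := link_mass_gt0 t0 IS.
have bE e : e \notin S -> \sum_(X : {set T} | e \in X) w X = t * link_mass t (e |: S).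
  by move=> eS; rewrite /link_mass -wmE //; apply: eq_bigr => X _; rewrite mulr1.
pose m := link_mean h t S.
have := @projection_le _ _ w (~: S) w_ge0 _ K K0 _ (fun X => h X - m).
rewrite !ZE => /(_ Z0) H.
have {}H := H _ _.
have V : \sum_X w X * (h X - m) ^+ 2 = link_var h t S.
  transitivity (\sum_X w X * h X ^+ 2 - 2 * m * \sum_X w X * h X + m ^+ 2 * \sum_X w X).
    rewrite !mulr_sumr -sumrN -!big_split; apply: eq_bigr => X _ /=; ring.
  by rewrite !wE ZE /link_var /m /link_mean; field; rewrite gt_eqF.
rewrite V in H.
rewrite mulrAC ler_pdivlMr // mulrC; apply: le_trans (H _ _).
- rewrite mulr_sumr; apply: ler_sum => e; rewrite inE => eS.
  rewrite bE //.
  have -> : \sum_(X : {set T} | e \in X) w X * (h X - m) =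
      t * link_sum h t (e |: S) - m * (t * link_mass t (e |: S)).
    rewrite -wmE // -bE // mulr_sumr -sumrB; apply: eq_bigr => X _; ring.
  have [IeS|NIeS] := boolP (I (e |: S)); last first.
    by rewrite /link_mass !link_sum_notin // !(mulr0, mul0r).
  have Ze0 := link_mass_gt0 t0 IeS.
  rewrite le_eqVlt; apply/orP; left; apply/eqP.
  by rewrite /m /link_mean; field; rewrite !gt_eqF.
- move=> e; rewrite inE => eS; rewrite bE // => b0.
  have IeS : I (e |: S).
    by apply: contraT => N; rewrite /link_mass link_sum_notin // mulr0 ltxx in b0.
  have Ze0 := link_mass_gt0 t0 IeS.
  apply: le_trans (infl e eS IeS); apply: ler_sum => e' _.
  rewrite le_eqVlt; apply/orP; left; apply/eqP; congr (`|_ - _|).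
    have -> : \sum_(X : {set T} | (e \in X) && (e' \in X)) w X =
       t * link_sum (fun X => (e' \in X)%:R) t (e |: S).
      rewrite -wmE // big_mkcondr; apply: eq_bigr => X _.
      by case: (e' \in X); rewrite ?mulr0 ?mulr1.
    by rewrite /link_prob; field; rewrite !gt_eqF.
  rewrite /link_prob -wE big_mkcond; congr (_ / _); apply: eq_bigr => X _.
  by case: (e' \in X); rewrite ?mulr0 ?mulr1.
- rewrite (eq_bigr (fun X => w X * h X - m * w X)) => [|X _]; last by ring.
  rewrite sumrB -mulr_sumr wE ZE /m /link_mean -mulrA mulVf ?mulr1 ?subrr //.
  by rewrite gt_eqF.
Qed.

(** Pairs of a set and one of its elements correspond to pairs of a set and an element that can be
    added. This shifts the derivative of [(1 - t) ^+ #|S|] from [S] to [e |: S] in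
    [is_derive_revealed_var]. *)
Lemma sum_link_mem (h : {set T} -> R) :
  \sum_(S | I S) \sum_(e in S) h S =
  \sum_(S | I S) \sum_(e in ~: S) if I (e |: S) then h (e |: S) else 0.
Proof.
rewrite (exchange_big_dep predT) //= [RHS](exchange_big_dep predT) //=.
apply: eq_bigr => e _.
rewrite (reindex_onto (fun S => e |: S) (fun S => S :\ e)) /=; last first.
  by move=> S /andP[_ eS]; rewrite setD1K.
rewrite -big_mkcondr; apply: eq_big => [S|//].
rewrite !inE eqxx andbT; apply/andP/andP => [[IeS /eqP E]|[/andP[IS eS] IeS]].
  have IS := I_down (subsetUr [set e] S) IeS.
  by split=> //; rewrite IS -E !inE eqxx.
by rewrite IeS setU1K.
Qed.

(** The left side is the derivative of [link_sum h t S] in [t]; its factor [#|X :\: S|] counts the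
    elements [e] of [X :\: S]. *)
Lemma link_sum_deriv h t S :
  \sum_(X | I X && (S \subset X)) h X * (#|X :\: S|%:R * t ^+ #|X :\: S|.-1) =
  \sum_(e in ~: S) link_sum h t (e |: S).
Proof.
rewrite /link_sum.
rewrite (exchange_big_dep (fun X => I X && (S \subset X))) /=; last first.
  by move=> e X _ /andP[-> /(subset_trans _)->] //; rewrite subsetUr.
apply: eq_bigr => X /andP[IX SX].
transitivity (\sum_(e in X :\: S) h X * t ^+ #|X :\: S|.-1).
  by rewrite sumr_const -mulr_natl; ring.
apply: eq_big => [e|e].
  by rewrite !inE IX /= subUset sub1set SX andbT.
by rewrite inE => /andP[eS eX]; rewrite (card_setDU1 eS eX).
Qed.

End Complex.

(** * Matchings avoiding a set of vertices *)

Section Matchings.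
Variable G : sgraph.
Implicit Types (A : {set vertex G}) (u w : vertex G) (e : {set vertex G}).
Implicit Types (B C : {set vertex G}) (S M X : {set {set vertex G}}).

Lemma edgesP e : reflect (exists2 p : vertex G * vertex G, adj p.1 p.2 & e = [set p.1; p.2]) (e \in edges G).
Proof. by apply: (iffP imsetP) => [[p pe ->]|[p pe ->]]; exists p. Qed.

Lemma matchingP M : reflect (M \subset edges G /\
    forall B C, B \in M -> C \in M -> forall x, x \in B -> x \in C -> B = C) (is_matching M).
Proof.
apply: (iffP andP) => [[ME /trivIsetP tM]|[ME tM]]; split=> //.
  move=> B C BM CM x xB xC; apply/eqP; apply: contraT => BC.
  by have /pred0P/(_ x) := tM B C BM CM BC; rewrite /= xB xC.
apply/trivIsetP => B C BM CM BC; apply/pred0P => x /=.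
by apply/negP => /andP[xB xC]; rewrite (tM B C BM CM x) ?eqxx in BC.
Qed.

Lemma matching_down X M : X \subset M -> is_matching M -> is_matching X.
Proof.
move=> /subsetP XM /matchingP[ME tM]; apply/matchingP; split.
  by apply/subsetP => e /XM; exact: (subsetP ME).
by move=> B C /XM BM /XM CM; exact: tM.
Qed.

(** This turns pinning the edges of [S] into deleting the vertices that they cover. *)
Lemma matchingU S M : is_matching S ->
  is_matching (S :|: M) && [disjoint S & M] =
  is_matching M && (cover M \subset ~: cover S).
Proof.
move=> mS; have /matchingP[SE tS] := mS.
apply/andP/andP => [[mSM dSM]|[mM cM]].
  split; first by apply: matching_down mSM; rewrite subsetUr.
  apply/subsetP => x /bigcupP[B BM xB]; rewrite inE; apply/bigcupP => -[C CS xC].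
  have /matchingP[_ /(_ B C)] := mSM; rewrite !inE BM CS orbT => /(_ isT isT x xB xC) BC.
  by have /pred0P/(_ C) := dSM; rewrite /= CS -BC BM.
have cross B C x : B \in M -> C \in S -> x \in B -> x \in C -> False.
  move=> BM CS xB xC; have /subsetP/(_ x) := cM.
  rewrite inE => /(_ _)/negP []; first by apply/bigcupP; exists B.
  by apply/bigcupP; exists C.
have /matchingP[ME tM] := mM; split.
  apply/matchingP; split; first by rewrite subUset SE.
  move=> B C; rewrite !inE => /orP[BS|BM] /orP[CS|CM] x xB xC.
  - exact: (tS _ _ BS CS x).
  - by case: (cross C B x).
  - by case: (cross B C x).
  - exact: (tM _ _ BM CM x).
apply/pred0P => B /=; apply/negP => /andP[BS BM].
(* An edge is nonempty, so one lying in both [S] and [M] would give a vertex covered by both. *)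
have /edgesP[p _ BE] := subsetP SE B BS.
by apply: (cross B B p.1) => //; rewrite BE !inE eqxx.
Qed.

Lemma matching_set1 e : e \in edges G -> is_matching [set e].
Proof.
move=> eE; apply/matchingP; split; first by rewrite sub1set.
by move=> B C /set1P-> /set1P->.
Qed.

Lemma matching0 : is_matching (set0 : {set {set vertex G}}).
Proof. by apply/matchingP; split=> [|B C]; rewrite ?sub0set ?inE. Qed.

Lemma matchingU1 e M : e \in edges G ->
  is_matching (e |: M) && (e \notin M) = is_matching M && (cover M \subset ~: e).
Proof.
by move=> eE; rewrite -disjoints1 matchingU ?matching_set1 // cover1.
Qed.

(** * Sums over the matchings of an induced subgraph *)

Section Sums.
Variable R : realFieldType.
Implicit Types (g : {set {set vertex G}} -> R).

(** The subgraph induced on [A] is never built: its matchings are those of [G] with cover inside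
    [A], so deleting a vertex changes only [A]. *)
Definition matching_sum g A : R :=
  \sum_(M | is_matching M && (cover M \subset A)) g M.

Lemma partner_unique A M u w0 : is_matching M -> cover M \subset A ->
  adj u w0 -> [set u; w0] \in M ->
  (fun w => [&& w \in A, adj u w & [set u; w] \in M]) =1 pred1 w0.
Proof.
move=> /matchingP[ME tM] cM uw0 uw0M w /=; apply/and3P/eqP => [[wA uw uwM]|->].
  have /setP/(_ w) : [set u; w] = [set u; w0] by apply: (tM _ _ _ _ u); rewrite ?set21.
  rewrite !inE eqxx orbT => /esym/orP[/eqP wu|/eqP //].
  by rewrite wu adj_irr in uw.
by split=> //; apply: (subsetP cM); apply/bigcupP; exists [set u; w0]; rewrite ?set22.
Qed.

(** Split on the status of [u]: it is unmatched, or it has exactly one partner [w], and then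
    removing their edge leaves a matching that avoids both. *)
Lemma matching_sum_rec g A u : u \in A ->
  matching_sum g A = matching_sum g (A :\ u) +
    \sum_(w in A | adj u w) matching_sum (fun M => g ([set u; w] |: M)) (A :\ u :\ w).
Proof.
move=> uA; rewrite /matching_sum (bigID (fun M => u \notin cover M)) /=; congr (_ + _).
  by apply: eq_bigl => M; rewrite subsetD1 andbA.
transitivity (\sum_(M | is_matching M && (cover M \subset A))
    \sum_(w in A | adj u w) if [set u; w] \in M then g M else 0).
  rewrite big_mkcondr; apply: eq_bigr => M /andP[mM cM].
  rewrite negbK; case: ifPn => [/bigcupP[e eM ue]|uM]; last first.
    rewrite big1 // => w _; case: ifP => // uwM; case/negP: uM.
    by apply/bigcupP; exists [set u; w]; rewrite ?set21.
  have /matchingP[ME _] := mM.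
  have [w0 uw0 eE] : exists2 w, adj u w & e = [set u; w].
    have /edgesP[p pe eE] := subsetP ME e eM.
    move: ue; rewrite eE !inE => /orP[]/eqP->; first by exists p.2.
    by exists p.1; rewrite 1?adj_sym // setUC.
  rewrite -big_mkcondr /= (big_pred1 w0) // => w.
  by rewrite -(partner_unique mM cM uw0) -?eE //= andbA.
rewrite exchange_big /=; apply: eq_bigr => w /andP[wA uw].
have uwE : [set u; w] \in edges G by apply/edgesP; exists (u, w).
rewrite -big_mkcondr /=.
rewrite (reindex_onto (fun M => [set u; w] |: M) (fun M => M :\ [set u; w])) /=; last first.
  by move=> M /andP[_ uwM]; rewrite setD1K.
apply: eq_bigl => M.
have -> : (([set u; w] |: M) :\ [set u; w] == M) = ([set u; w] \notin M).
  by apply/eqP/idP => [<-|uwM]; [rewrite !inE eqxx|exact: setU1K].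
rewrite setU11 andbT andbAC matchingU1 //.
have -> : cover ([set u; w] |: M) = [set u; w] :|: cover M by rewrite /cover bigcup_setU big_set1.
have -> : ~: [set u; w] = setT :\ u :\ w.
  by apply/setP => x; rewrite !inE andbT negb_or andbC.
rewrite subUset subUset !sub1set uA wA !subsetD1 subsetT /=.
by case: (is_matching M); case: (u \in cover M); case: (w \in cover M); case: (cover M \subset A).
Qed.

End Sums.
End Matchings.

(** * Removing a vertex *)

Section Influence.
Variables (G : sgraph) (R : realFieldType).
Implicit Types (A : {set vertex G}) (u w : vertex G) (e : {set vertex G}).
Implicit Types (S M X : {set {set vertex G}}) (t : R).

Definition partition_fun t A : R := matching_sum (fun M => t ^+ #|M|) A.

Definition edge_weight t A e : R :=
  matching_sum (fun M => (e \in M)%:R * t ^+ #|M|) A.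

Definition edge_prob t A e : R := edge_weight t A e / partition_fun t A.

Definition unmatched_prob t A u : R :=
  partition_fun t (A :\ u) / partition_fun t A.

Definition removal_influence t A u : R :=
  \sum_e `|edge_prob t A e - edge_prob t (A :\ u) e|.

Local Notation Z := (partition_fun).
Local Notation p := (edge_prob).
Local Notation q := (unmatched_prob).
Local Notation infl := (removal_influence).

Lemma partition_fun_gt0 t A : 0 < t -> 0 < Z t A.
Proof.
move=> t0; rewrite /Z /matching_sum (bigD1 set0) /=; last first.
  by rewrite matching0 /cover big_set0 sub0set.
rewrite cards0 expr0 ltr_pwDl ?ltr01 //.
by apply: sumr_ge0 => M _; rewrite exprn_ge0 // ltW.
Qed.

Lemma avail_edge_notin u w A M : is_matching M && (cover M \subset A :\ u :\ w) ->
  [set u; w] \notin M.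
Proof.
move=> /andP[_ /subsetP cM]; apply/negP => uwM.
have /cM : u \in cover M by apply/bigcupP; exists [set u; w]; rewrite ?set21.
by rewrite !inE eqxx andbF.
Qed.

Lemma partition_fun_rec t A u : u \in A -> Z t A = Z t (A :\ u) +
  t * \sum_(w in A | adj u w) Z t (A :\ u :\ w).
Proof.
move=> uA; rewrite /Z (matching_sum_rec _ uA) mulr_sumr; congr (_ + _).
apply: eq_bigr => w _; rewrite /matching_sum mulr_sumr; apply: eq_bigr => M MA.
by rewrite cardsU1 (avail_edge_notin MA) exprS.
Qed.

Lemma edge_weight_rec t A u e : u \in A -> edge_weight t A e = edge_weight t (A :\ u) e +
  t * \sum_(w in A | adj u w)
    ((e == [set u; w])%:R * Z t (A :\ u :\ w) + edge_weight t (A :\ u :\ w) e).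
Proof.
move=> uA; rewrite /edge_weight (matching_sum_rec _ uA) mulr_sumr; congr (_ + _).
apply: eq_bigr => w _; rewrite /Z /matching_sum mulr_sumr -big_split mulr_sumr.
apply: eq_bigr => M MA /=; have uwM := avail_edge_notin MA.
rewrite cardsU1 uwM exprS in_setU1.
case: eqP => [->|_]; first by rewrite (negPf uwM) /= mul1r !mul0r addr0 mul1r.
by rewrite orFb !mul0r add0r mulrCA.
Qed.

Lemma unmatched_prob_gt0 t A u : 0 < t -> 0 < q t A u.
Proof. by move=> t0; rewrite divr_gt0 ?partition_fun_gt0. Qed.

(** The recurrence for the partition function divided by [Z t A]: the continued-fraction recursion
    for the probability that [u] is unmatched. *)
Lemma unmatched_prob_rec t A u : 0 < t -> u \in A ->
  q t A u * (1 + t * \sum_(w in A | adj u w) q t (A :\ u) w) = 1.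
Proof.
move=> t0 uA; have ZA := partition_fun_gt0 A t0.
have ZAu := partition_fun_gt0 (A :\ u) t0.
rewrite /q -mulr_suml; move: (partition_fun_rec t uA); set T := \sum_(w in A | _) _ => E.
have -> : 1 + t * (T / Z t (A :\ u)) = Z t A / Z t (A :\ u).
  by rewrite E; field; rewrite gt_eqF.
by rewrite mulrA divfK ?divff // gt_eqF.
Qed.

Lemma unmatched_prob_le1 t A u : 0 < t -> u \in A -> q t A u <= 1.
Proof.
move=> t0 uA; have q0 := unmatched_prob_gt0 A u t0.
rewrite -(unmatched_prob_rec t0 uA) ler_peMr ?(ltW q0) // lerDl mulr_ge0 ?(ltW t0) //.
by apply: sumr_ge0 => w _; rewrite ltW ?unmatched_prob_gt0.
Qed.

Lemma transition_ge0 t A u w : 0 < t -> 0 <= t * q t A u * q t (A :\ u) w.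
Proof.
move=> t0; apply: ltW; apply: mulr_gt0; last exact: unmatched_prob_gt0.
by apply: mulr_gt0 => //; exact: unmatched_prob_gt0.
Qed.

(** The law on [A] is a mixture: with probability [q t A u] it is the law on [A :\ u], and with
    probability [t * q t A u * q t (A :\ u) w] it is the edge from [u] to [w] plus the law on
    [A :\ u :\ w]. Subtracting the law on [A :\ u] removes the first case. *)
Lemma edge_prob_rec t A u e : 0 < t -> u \in A ->
  p t A e - p t (A :\ u) e =
  \sum_(w in A | adj u w) t * q t A u * q t (A :\ u) w *
     ((e == [set u; w])%:R + (p t (A :\ u :\ w) e - p t (A :\ u) e)).
Proof.
move=> t0 uA; have ZA := partition_fun_gt0 A t0.
have ZAu := partition_fun_gt0 (A :\ u) t0.
set P := p t (A :\ u) e.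
have EW : edge_weight t (A :\ u) e = Z t (A :\ u) * P by rewrite /P /p mulrC divfK ?gt_eqF.
have E : edge_weight t A e - Z t A * P = \sum_(w in A | adj u w)
    t * (((e == [set u; w])%:R * Z t (A :\ u :\ w) + edge_weight t (A :\ u :\ w) e)
         - Z t (A :\ u :\ w) * P).
  rewrite (edge_weight_rec t e uA) (partition_fun_rec t uA) EW -mulr_sumr sumrB -mulr_suml.
  ring.
have -> : p t A e - P = (edge_weight t A e - Z t A * P) / Z t A.
  by rewrite mulrBl [_ * P]mulrC mulfK ?gt_eqF.
rewrite E mulr_suml; apply: eq_bigr => w _.
have Zw := partition_fun_gt0 (A :\ u :\ w) t0.
by rewrite /q /p; field; rewrite !gt_eqF.
Qed.

(** Triangle inequality in [edge_prob_rec]. The 1 accounts for the edge from [u] to [w]; iterating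
    bounds the influence by the expected length of the alternating path. *)
Lemma removal_influence_le t A u : 0 < t -> u \in A ->
  infl t A u <= \sum_(w in A | adj u w) t * q t A u * q t (A :\ u) w * (1 + infl t (A :\ u) w).
Proof.
move=> t0 uA; rewrite /infl.
apply: (@le_trans _ _ (\sum_e \sum_(w in A | adj u w) t * q t A u * q t (A :\ u) w *
   ((e == [set u; w])%:R + `|p t (A :\ u) e - p t (A :\ u :\ w) e|))).
  apply: ler_sum => e _; rewrite (edge_prob_rec _ t0 uA).
  apply: le_trans (ler_norm_sum _ _ _) _; apply: ler_sum => w _.
  have a0 : 0 <= t * q t A u * q t (A :\ u) w.
    exact: transition_ge0.
  rewrite normrM ger0_norm // ler_wpM2l //.
  by rewrite [in leRHS]distrC; apply: le_trans (ler_normD _ _) _; rewrite normr_nat.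
rewrite exchange_big /=; apply: ler_sum => w _.
rewrite -mulr_sumr big_split /= le_eqVlt; apply/orP; left; apply/eqP.
congr (_ * (_ + _)); rewrite (bigD1 [set u; w]) //= eqxx big1 ?addr0 // => e.
by move=> /negPf->.
Qed.

Variable s : nat.
Hypothesis s_gt0 : (0 < s)%N.
Hypothesis degree_le : (max_degree G <= s ^ 2)%N.

Lemma neighbours_le A u : (#|[pred w in A | adj u w]| <= s ^ 2)%N.
Proof.
apply: leq_trans degree_le; apply: leq_trans (leq_bigmax u).
by apply/subset_leq_card/subsetP => w; rewrite !inE => /andP[].
Qed.

(** The alternating path stops at [u] with the remaining probability [q t A u]. *)
Lemma sum_transition t A u : 0 < t -> u \in A ->
  \sum_(w in A | adj u w) t * q t A u * q t (A :\ u) w = 1 - q t A u.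
Proof.
move=> t0 uA; rewrite -[in RHS](unmatched_prob_rec t0 uA) mulrDr mulr1 addrC addKr.
by rewrite !mulr_sumr; apply: eq_bigr => w _; ring.
Qed.

Lemma neighbour_avail A u w : w \in A -> adj u w -> w \in A :\ u.
Proof.
move=> wA uw; rewrite !inE wA andbT; apply/eqP => wu.
by rewrite wu adj_irr in uw.
Qed.

(** Induction on [#|A|]. With [c = t * s^2], the path leaves [u] with probability
    [1 - q = q T <= q c], and [1 - q <= q c] is the same as [(1 - q) (1 + c) <= c]. *)
Lemma removal_influence_small t A u : 0 < t -> u \in A -> infl t A u <= t * (s ^ 2)%:R.
Proof.
move=> t0; have [n] := ubnP #|A|; elim: n A u => // n IH A u An uA.
set c := t * _; have c0 : 0 <= c by rewrite mulr_ge0 ?(ltW t0).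
have q0 := unmatched_prob_gt0 A u t0.
apply: le_trans (removal_influence_le t0 uA) _.
apply: (@le_trans _ _ (\sum_(w in A | adj u w) t * q t A u * q t (A :\ u) w * (1 + c))).
  apply: ler_sum => w /andP[wA uw]; rewrite ler_wpM2l ?transition_ge0 //.
  rewrite lerD2l IH ?neighbour_avail //.
  by move: An; rewrite (cardsD1 u) uA.
rewrite -mulr_suml sum_transition //.
have : t * \sum_(w in A | adj u w) q t (A :\ u) w <= c.
  rewrite ler_wpM2l ?(ltW t0) //.
  apply: (@le_trans _ _ (\sum_(w in A | adj u w) 1)).
    apply: ler_sum => w /andP[wA uw].
    by rewrite unmatched_prob_le1 ?neighbour_avail.
  by rewrite sumr_const ler_nat neighbours_le.
have := unmatched_prob_rec t0 uA.
set T := t * _ => qT Tc; have {}Tc : q t A u * T <= q t A u * c by rewrite ler_wpM2l ?(ltW q0).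
lra.
Qed.

(* The weights t q(A,u) q(A\u,w) are the transition probabilities of the
   alternating path.  Two of its steps are unrolled: the path leaves u with
   probability q T and stops at the next vertex with probability q Y, where
   Y >= 2 T / s - 1 because the at most s^2 numbers q(A\u,w) sum to T / t. *)
Lemma removal_influence_sqrt t A u : 0 < t -> t <= 1 -> u \in A ->
  infl t A u <= 2 * (1 + s%:R).
Proof.
move=> t0 t1; set B := 2 * _.
have s0 : 0 < s%:R :> R by rewrite ltr0n.
have [n] := ubnP #|A|; elim: n A u => // n IH A u An uA.
have q0 := unmatched_prob_gt0 A u t0.
have cardA : (#|A :\ u| < n)%N by move: An; rewrite (cardsD1 u) uA.
(* The second step of the path; the induction hypothesis is used for the vertices after [w], in
   [A :\ u :\ w]. *)
have IH1 w : w \in A -> adj u w ->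
    infl t (A :\ u) w <= (1 - q t (A :\ u) w) * (1 + B).
  move=> wA uw; have wAu := neighbour_avail wA uw.
  apply: le_trans (removal_influence_le t0 wAu) _.
  rewrite -sum_transition // mulr_suml; apply: ler_sum => x /andP[xA wx].
  rewrite ler_wpM2l ?transition_ge0 //.
  rewrite lerD2l; apply: IH; last exact: neighbour_avail xA wx.
  by move: cardA; rewrite (cardsD1 w) wAu add1n => /ltnW.
apply: le_trans (removal_influence_le t0 uA) _.
set T := t * \sum_(w in A | adj u w) q t (A :\ u) w.
set Y := t * \sum_(w in A | adj u w) q t (A :\ u) w ^+ 2.
have qT : q t A u * (1 + T) = 1 by exact: unmatched_prob_rec.
have Y0 : 0 <= Y by rewrite mulr_ge0 ?(ltW t0) // sumr_ge0 // => w _; exact: sqr_ge0.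
have TY : 2 * T / s%:R - 1 <= Y.
  (* In the expansion of these squares the constants [s^-2] add up to at most [t * s^2 / s^2 <= 1],
     the 1 subtracted in [TY]. *)
  have H : 0 <= t * \sum_(w in A | adj u w) (q t (A :\ u) w - s%:R^-1) ^+ 2.
    by rewrite mulr_ge0 ?(ltW t0) // sumr_ge0 // => w _; exact: sqr_ge0.
  have E : t * \sum_(w in A | adj u w) (q t (A :\ u) w - s%:R^-1) ^+ 2 =
     Y - 2 * T / s%:R + t * ((#|[pred w in A | adj u w]|)%:R * s%:R ^- 2).
    set r := s%:R^-1.
    transitivity (t * (\sum_(w in A | adj u w) q t (A :\ u) w ^+ 2
        - 2 * r * \sum_(w in A | adj u w) q t (A :\ u) w + \sum_(w in A | adj u w) r ^+ 2)).
      congr (_ * _); rewrite mulr_sumr -sumrB -big_split.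
      by apply: eq_bigr => w _ /=; ring.
    by rewrite sumr_const -[_ *+ #|_|]mulr_natl /Y /T -exprVn -/r; ring.
  have N : t * ((#|[pred w in A | adj u w]|)%:R * s%:R ^- 2) <= 1.
    apply: mulr_ile1; rewrite ?(ltW t0) ?mulr_ge0 ?invr_ge0 ?exprn_ge0 //.
    by rewrite ler_pdivrMr ?exprn_gt0 // mul1r -natrX ler_nat neighbours_le.
  lra.
have T0 : 0 <= T.
  by rewrite mulr_ge0 ?(ltW t0) // sumr_ge0 // => w _; rewrite ltW ?unmatched_prob_gt0.
apply: (@le_trans _ _ (q t A u * ((2 + B) * T - (1 + B) * Y))).
  rewrite /T /Y !mulr_sumr -sumrB mulr_sumr; apply: ler_sum => w /andP[wA uw].
  have := IH1 w wA uw.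
  have a0 : 0 <= t * q t A u * q t (A :\ u) w.
    exact: transition_ge0.
  move=> /(ler_wpM2l a0); lra.
suff H : (2 + B) * T - (1 + B) * Y <= B * (1 + T).
  by apply: le_trans (ler_wpM2l (ltW q0) H) _; rewrite mulrCA qT mulr1.
have s1 : 1 <= s%:R :> R by rewrite ler1n.
have B0 : 0 <= 1 + B by rewrite /B; lra.
(* For small [T] the bound [Y >= 0] suffices, because [2 T <= 2 (1 + s) = B]; this fixes [B]. For
   large [T], [TY] makes the path stop often enough at its second vertex. *)
have [Ts|sT] := leP T (1 + s%:R).
  by have := mulr_ge0 B0 Y0; rewrite /B; lra.
have : T / s%:R * s%:R = T by rewrite divfK // gt_eqF.
have : 0 <= T / s%:R by rewrite divr_ge0 // ltW.
move: TY => /(ler_wpM2l B0); rewrite -mulrA; move: (T / s%:R) => r + r0 rs.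
by rewrite /B -rs in sT *; lra.
Qed.

End Influence.

(** * Influences between edges of a matching *)

Section LinkInfluence.
Variables (G : sgraph) (R : realFieldType).
Implicit Types (e : {set vertex G}) (S M X : {set {set vertex G}}) (t : R).

Lemma link_sum_matching (g : {set {set vertex G}} -> R) t S : is_matching S ->
  link_sum (@is_matching G) g t S =
  matching_sum (fun M => g (S :|: M) * t ^+ #|M|) (~: cover S).
Proof.
move=> mS; rewrite /link_sum /matching_sum.
rewrite (reindex_onto (fun M => S :|: M) (fun X => X :\: S)) /=; last first.
  by move=> X /andP[_ SX]; rewrite setDE setUIr setUCr setIT (setUidPr SX).
have E M : ((S :|: M) :\: S == M) = [disjoint S & M].
  by rewrite setDUl setDv set0U disjoint_sym; apply/eqP/setDidPl.
apply: eq_big => [M|M /andP[_ /eqP ->] //].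
by rewrite E subsetUl andbT matchingU.
Qed.

Lemma link_prob_matching t S e : is_matching S -> e \notin S ->
  link_prob (@is_matching G) t S e = edge_prob t (~: cover S) e.
Proof.
move=> mS eS; rewrite /link_prob /edge_prob /link_mass !link_sum_matching //.
congr (_ / _); apply: eq_bigr => M _; last by rewrite mul1r.
by rewrite in_setU (negPf eS).
Qed.

Lemma link_prob_ge0 t S e : 0 < t -> 0 <= link_prob (@is_matching G) t S e.
Proof.
move=> t0; rewrite divr_ge0 ?sumr_ge0 // => X _;
by rewrite mulr_ge0 ?ler0n ?exprn_ge0 ?(ltW t0).
Qed.

Lemma link_prob_le1 t S e : 0 < t -> is_matching S -> link_prob (@is_matching G) t S e <= 1.
Proof.
move=> t0 mS; rewrite /link_prob ler_pdivrMr ?mul1r.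
  apply: ler_sum => X _; rewrite ler_wpM2r ?exprn_ge0 ?(ltW t0) //.
  by case: (e \in X).
exact: link_mass_gt0.
Qed.

(** Pinning [e] deletes its endpoints one after the other, each at a cost of at most [B]. The
    remaining 1 bounds the change for [e] itself, whose probability becomes 1. *)
Lemma link_influence_le t S e (B : R) : 0 < t -> is_matching S ->
  e \notin S -> is_matching (e |: S) ->
  (forall (A : {set vertex G}) u, u \in A -> removal_influence t A u <= B) ->
  \sum_(e' in ~: S) `|link_prob (@is_matching G) t (e |: S) e'
    - link_prob (@is_matching G) t S e'| <= 1 + 2 * B.
Proof.
move=> t0 mS eS meS infl.
have eE : e \in edges G.
  by have /matchingP[/subsetP meE _] := meS; apply: meE; rewrite setU11.
have [[u v] /= uv eE'] := elimT (edgesP e) eE.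
have : cover S \subset ~: e.
  by have := matchingU1 S eE; rewrite meS eS mS => /esym/andP[].
rewrite -setCS setCK => eA; pose A := ~: cover S.
have uA : u \in A by apply: (subsetP eA); rewrite eE' set21.
have vA : v \in A :\ u by apply: neighbour_avail uv; apply: (subsetP eA); rewrite eE' set22.
have AE : ~: cover (e |: S) = A :\ u :\ v.
  rewrite /cover bigcup_setU big_set1 -/(cover S) eE'.
  by apply/setP => x; rewrite !inE !negb_or andbA [(x != u) && _]andbC.
rewrite (bigD1 e) /= ?inE // lerD //.
  have -> : link_prob (@is_matching G) t (e |: S) e = 1.
    have Z0 := link_mass_gt0 t0 meS.
    rewrite /link_prob (_ : link_sum _ _ _ _ = link_mass (@is_matching G) t (e |: S)).
      by rewrite divff ?gt_eqF.
    by apply: eq_bigr => X /andP[_ /subsetP->] //; rewrite setU11.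
  by rewrite ger0_norm ?subr_ge0 ?link_prob_le1 // gerBl link_prob_ge0.
apply: (@le_trans _ _ (\sum_e' (`|edge_prob t A e' - edge_prob t (A :\ u) e'|
   + `|edge_prob t (A :\ u) e' - edge_prob t (A :\ u :\ v) e'|))).
  rewrite big_mkcond /=; apply: ler_sum => e' _; case: ifP => [|_]; last exact: addr_ge0.
  rewrite inE => /andP[e'S e'e].
  rewrite !link_prob_matching ?AE //; last by rewrite in_setU1 negb_or e'e.
  rewrite distrC; apply: le_trans (ler_normD _ _).
  by rewrite le_eqVlt; apply/orP; left; apply/eqP; congr (`|_|); rewrite -/A; ring.
by rewrite big_split /= mulr_natl mulr2n lerD // infl.
Qed.

End LinkInfluence.

(** * The Glauber dynamics *)

Lemma setD1_notin (T : finType) (A : {set T}) x : x \notin A -> A :\ x = A.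
Proof. by move=> xA; apply/setDidPl; rewrite disjoint_sym disjoints1. Qed.

Section Glauber.
Variables (R : realType) (G : sgraph).
Implicit Types (e : {set vertex G}) (M N : matching G) (f : matching G -> R).

Local Notation agree := (@agree_off G).
Local Notation m := (size_of G).

Lemma card_matching_gt0 : (0 < #|matching G|)%N.
Proof. by apply/card_gt0P; exists (Sub set0 (matching0 G)). Qed.

Lemma resampleE e M N :
  resample R e M N = if agree e M N then (#|[pred N' | agree e M N']|%:R)^-1 else 0.
Proof.
rewrite /resample; case: ifP => // a.
rewrite /monomer_dimer sumr_const -[_^-1 *+ _]mulr_natr invfM invrK mulrA mulVf ?mul1r //.
by rewrite pnatr_eq0 -lt0n card_matching_gt0.
Qed.

Lemma agree_eqP e M N : agree e M N -> agree e M =1 agree e N.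
Proof. by rewrite /agree_off => /eqP E N'; rewrite E. Qed.

Lemma resample_sym e M N : resample R e M N = resample R e N M.
Proof.
rewrite !resampleE [agree e N M]/agree_off eq_sym -/(agree e M N).
by case: ifP => // a; congr (_%:R^-1); apply: eq_card => N'; exact: agree_eqP.
Qed.

Lemma resample_ge0 e M N : 0 <= resample R e M N.
Proof. by rewrite resampleE; case: ifP => // _; rewrite invr_ge0. Qed.

Lemma sum_resample e M : \sum_N resample R e M N = 1.
Proof.
under eq_bigr do rewrite resampleE.
rewrite -big_mkcond sumr_const -[_ *+ _]mulr_natr mulVf // pnatr_eq0 -lt0n.
by apply/card_gt0P; exists M; rewrite inE /agree_off eqxx.
Qed.

(** Conditional expectation of [f] given all edges but [e]. As [resample] is symmetric, the same
    operator also advances distributions. *)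
Definition average e f M : R := \sum_N resample R e M N * f N.

(** [average e] is an orthogonal projection: it is symmetric, and [average e f] is constant on each
    class of [agree_off e]. *)
Lemma sum_average_sqr e f :
  \sum_M average e f M ^+ 2 = \sum_M f M * average e f M.
Proof.
transitivity (\sum_M \sum_N resample R e N M * f N * average e f M).
  by apply: eq_bigr => M _; rewrite -mulr_suml expr2; congr (_ * _);
     apply: eq_bigr => N _; rewrite resample_sym.
rewrite exchange_big /=; apply: eq_bigr => N _.
transitivity (\sum_M f N * average e f N * resample R e N M); last first.
  by rewrite -mulr_sumr sum_resample mulr1.
apply: eq_bigr => M _; rewrite [in LHS]resampleE [in RHS]resampleE.
case: ifP => a; last by rewrite !mul0r mulr0.
suff -> : average e f M = average e f N by ring.
apply: eq_bigr => N' _; rewrite !resampleE (agree_eqP a).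
by congr ((if _ then _%:R^-1 else 0) * _); apply: eq_card => ?; rewrite !inE (agree_eqP a).
Qed.

Lemma dirichlet_form e f :
  \sum_M f M * (f M - average e f M) =
  2^-1 * \sum_M \sum_N resample R e M N * (f M - f N) ^+ 2.
Proof.
have E : \sum_M \sum_N resample R e M N * (f M - f N) ^+ 2 =
  \sum_M f M ^+ 2 - 2 * (\sum_M f M * average e f M) + \sum_M f M ^+ 2.
  transitivity (\sum_M \sum_N resample R e M N * f M ^+ 2 -
     2 * (\sum_M \sum_N f M * (resample R e M N * f N)) + \sum_M \sum_N resample R e M N * f N ^+ 2).
    rewrite mulr_sumr -sumrB -big_split; apply: eq_bigr => M _ /=.
    by rewrite mulr_sumr -sumrB -big_split; apply: eq_bigr => N _ /=; ring.
  congr (_ - _ * _ + _).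
  - by apply: eq_bigr => M _; rewrite -mulr_suml sum_resample mul1r.
  - by apply: eq_bigr => M _; rewrite -mulr_sumr.
  - rewrite exchange_big; apply: eq_bigr => M _ /=.
    under eq_bigr do rewrite resample_sym.
    by rewrite -mulr_suml sum_resample mul1r.
rewrite E (eq_bigr (fun M => f M ^+ 2 - f M * average e f M)) => [|M _]; last by ring.
by rewrite sumrB; lra.
Qed.

(** A class of [agree_off e] has at most two members, one with [e] and one without. *)
Lemma resample_ge_half e M N : agree e M N -> 2^-1 <= resample R e M N.
Proof.
move=> a; rewrite resampleE a lef_pV2 ?posrE ?ltr0n //; last first.
  by apply/card_gt0P; exists N; rewrite inE.
rewrite ler_nat -(card_imset _ val_inj).
apply: leq_trans (_ : #|[set val M :\ e; e |: (val M :\ e)]| <= 2)%N; last first.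
  by rewrite cards2; case: (_ != _).
apply/subset_leq_card/subsetP => X /imsetP[N']; rewrite inE => /eqP aN' ->.
rewrite !inE aN'; case: (boolP (e \in val N')) => eN'.
  by rewrite setD1K ?eqxx ?orbT.
by rewrite (setD1_notin eN') eqxx.
Qed.

Lemma sum_matching (h : {set {set vertex G}} -> R) :
  \sum_(X | is_matching X) h X = \sum_(M : matching G) h (val M).
Proof.
rewrite (reindex_omap (val : matching G -> {set {set vertex G}}) insub) /=; last first.
  by move=> X mX; rewrite insubT.
by apply: eq_bigl => M; rewrite valK eqxx (valP M).
Qed.

(** The results on links concern functions of arbitrary sets; 0 is the default off matchings. *)
Definition extend f (X : {set {set vertex G}}) : R :=
  if insub X is Some M then f M else 0.

Lemma extend_val f M : extend f (val M) = f M.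
Proof. by rewrite /extend valK. Qed.

(** Of the factor 4, one 2 undoes the half in [dirichlet_form], the other pays for
    [resample_ge_half]. Each addition of [e] is one of the moves counted by the Dirichlet form. *)
Lemma energy_le f :
  \sum_(S | is_matching S) \sum_(e in ~: S)
     (if is_matching (e |: S) then (extend f (e |: S) - extend f S) ^+ 2 else 0) <=
  4 * \sum_(e in edges G) \sum_M f M * (f M - average e f M).
Proof.
rewrite sum_matching; under eq_bigr do rewrite extend_val.
apply: (@le_trans _ _ (\sum_M \sum_(e in edges G)
   2 * \sum_N resample R e M N * (f M - f N) ^+ 2)); last first.
  rewrite exchange_big mulr_sumr; apply: ler_sum => e _ /=.
  by rewrite -mulr_sumr dirichlet_form; lra.
apply: ler_sum => M _; rewrite big_mkcond [leRHS]big_mkcond /=; apply: ler_sum => e _.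
have rhs0 : 0 <= 2 * \sum_N resample R e M N * (f M - f N) ^+ 2.
  by rewrite mulr_ge0 // sumr_ge0 // => N _; rewrite mulr_ge0 ?sqr_ge0 ?resample_ge0.
case: ifP => [|_]; last by case: ifP.
rewrite inE => eM; case: ifP => [meM|_]; last by case: ifP.
have -> : e \in edges G.
  by have /matchingP[/subsetP meE _] := meM; apply: meE; rewrite setU11.
pose N : matching G := Sub (e |: val M) meM.
have -> : extend f (e |: val M) = f N by rewrite -extend_val.
rewrite (bigD1 N) //=.
have a : agree e M N by rewrite /agree_off /= setU1K // (setD1_notin eM).
have := ler_wpM2r (sqr_ge0 (f M - f N)) (resample_ge_half a).
have : 0 <= \sum_(i | i != N) resample R e M i * (f M - f i) ^+ 2.
  by apply: sumr_ge0 => i _; rewrite mulr_ge0 ?sqr_ge0 ?resample_ge0.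
have -> : (f N - f M) ^+ 2 = (f M - f N) ^+ 2 by ring.
lra.
Qed.

Lemma glauber_stepE f N : glauber_step f N = m%:R^-1 * \sum_(e in edges G) average e f N.
Proof.
rewrite /glauber_step /average exchange_big mulr_sumr; apply: eq_bigr => M _ /=.
rewrite /glauber mulrCA; congr (_ * _); rewrite mulr_sumr.
by apply: eq_bigr => e _; rewrite resample_sym mulrC.
Qed.

Lemma sqr_sum_le (J : finType) (A : {pred J}) (a : J -> R) :
  (\sum_(i in A) a i) ^+ 2 <= #|A|%:R * \sum_(i in A) a i ^+ 2.
Proof.
have [A0|A0] := posnP #|A|.
  by rewrite A0 mul0r big_pred0 ?expr0n // => i; exact: (card0_eq A0 i).
have n0 : 0 < #|A|%:R :> R by rewrite ltr0n.
set s := \sum_(i in A) a i; set n := #|A|%:R in n0 *.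
have : 0 <= n * \sum_(i in A) (a i - s / n) ^+ 2.
  by rewrite mulr_ge0 ?(ltW n0) // sumr_ge0 // => i _; exact: sqr_ge0.
suff -> : n * \sum_(i in A) (a i - s / n) ^+ 2 = n * \sum_(i in A) a i ^+ 2 - s ^+ 2.
  by rewrite subr_ge0.
have -> : \sum_(i in A) (a i - s / n) ^+ 2 =
   \sum_(i in A) a i ^+ 2 - 2 * (s / n) * s + \sum_(i in A) (s / n) ^+ 2.
  rewrite {3}/s mulr_sumr -sumrB -big_split.
  by apply: eq_bigr => i _ /=; ring.
rewrite sumr_const -[_ *+ #|_|]mulr_natl -/n.
by field; rewrite gt_eqF.
Qed.

(* Each single-edge update is an orthogonal projection, so their average P
   satisfies P^2 <= P: no bound on negative eigenvalues is needed. *)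
Lemma sum_glauber_step_sqr f : (0 < m)%N ->
  \sum_N glauber_step f N ^+ 2 <= \sum_N f N * glauber_step f N.
Proof.
move=> m0; have mr0 : 0 < m%:R :> R by rewrite ltr0n.
apply: (@le_trans _ _ (\sum_N m%:R^-1 * \sum_(e in edges G) average e f N ^+ 2)).
  apply: ler_sum => N _; rewrite glauber_stepE exprMn expr2 -mulrA.
  rewrite ler_pM2l ?invr_gt0 // ler_pdivrMl //; exact: sqr_sum_le.
rewrite -mulr_sumr exchange_big /=.
under eq_bigr do rewrite sum_average_sqr.
rewrite exchange_big mulr_sumr le_eqVlt; apply/orP; left; apply/eqP.
by apply: eq_bigr => N _ /=; rewrite glauber_stepE -mulr_sumr mulrCA.
Qed.

Lemma sum_glauber_step f : (0 < m)%N -> \sum_N glauber_step f N = \sum_N f N.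
Proof.
move=> m0; have mr0 : m%:R != 0 :> R by rewrite pnatr_eq0 -lt0n.
under eq_bigr do rewrite glauber_stepE.
rewrite -mulr_sumr exchange_big /= (eq_bigr (fun=> \sum_N f N)) => [|e _].
  by rewrite sumr_const -[(\sum_N f N) *+ _]mulr_natl mulrA mulVf ?mul1r.
rewrite exchange_big; apply: eq_bigr => N _ /=.
by under eq_bigr do rewrite resample_sym; rewrite -mulr_suml sum_resample mul1r.
Qed.

Definition deviation (pi : matching G -> R) M : R := pi M - monomer_dimer R G M.

(** Stationarity: every [average e] fixes constants, hence the uniform measure. With no edge the
    kernel is zero and this fails, so [m] must be positive. *)
Lemma deviation_step pi : (0 < m)%N ->
  deviation (glauber_step pi) =1 glauber_step (deviation pi).
Proof.
move=> m0 N; have mr0 : m%:R != 0 :> R by rewrite pnatr_eq0 -lt0n.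
rewrite /deviation !glauber_stepE.
have -> : \sum_(e in edges G) average e (fun M => pi M - monomer_dimer R G M) N =
   \sum_(e in edges G) (average e pi N - #|matching G|%:R^-1).
  apply: eq_bigr => e _; rewrite /average /monomer_dimer.
  under eq_bigr do rewrite mulrBr.
  by rewrite sumrB -mulr_suml sum_resample mul1r.
by rewrite sumrB sumr_const -[_^-1 *+ _]mulr_natl mulrBr mulKf.
Qed.

(** * Decay of the chi-square distance *)

Section Gap.
Variable C : R.
Hypothesis C_ge1 : 1 <= C.
Hypothesis poincare : forall f, \sum_M f M = 0 ->
  \sum_M f M ^+ 2 <= C * \sum_(e in edges G) \sum_M f M * (f M - average e f M).

(** The Poincare inequality bounds the inner product of [f] with its image by [1 - 1/(C m)] times
    the squared norm, and [sum_glauber_step_sqr] bounds the squared norm of the image by that inner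
    product. *)
Lemma glauber_contraction f : (0 < m)%N -> \sum_M f M = 0 ->
  \sum_M glauber_step f M ^+ 2 <= (1 - (C * m%:R)^-1) * \sum_M f M ^+ 2.
Proof.
move=> m0 f0; have mr0 : 0 < m%:R :> R by rewrite ltr0n.
have C0 : 0 < C by exact: lt_le_trans C_ge1.
apply: le_trans (sum_glauber_step_sqr f m0) _.
have E : \sum_(e in edges G) \sum_M f M * (f M - average e f M) =
    m%:R * (\sum_M f M ^+ 2 - \sum_M f M * glauber_step f M).
  rewrite exchange_big /= mulrBr !mulr_sumr -sumrB; apply: eq_bigr => M _.
  rewrite -mulr_sumr sumrB sumr_const -[f M *+ _]mulr_natl glauber_stepE.
  by rewrite -/(size_of G); field; rewrite gt_eqF.
have := poincare f0; rewrite E mulrA mulrC -ler_pdivrMr ?mulr_gt0 //.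
lra.
Qed.

Lemma deviation_iter pi t : (0 < m)%N -> \sum_M pi M = 1 ->
  \sum_M deviation (iter t (@glauber_step R G) pi) M = 0 /\
  \sum_M deviation (iter t (@glauber_step R G) pi) M ^+ 2 <=
    (1 - (C * m%:R)^-1) ^+ t * \sum_M deviation pi M ^+ 2.
Proof.
move=> m0 pi1; elim: t => [|t [IH0 IH]] /=.
  rewrite expr0 mul1r; split=> //; rewrite sumrB pi1 sumr_const.
  by rewrite -[_^-1 *+ _]mulr_natl divff ?subrr // pnatr_eq0 -lt0n card_matching_gt0.
under eq_bigr do rewrite deviation_step //.
under [X in _ /\ X <= _]eq_bigr do rewrite deviation_step //.
split; first by rewrite sum_glauber_step.
apply: le_trans (glauber_contraction m0 IH0) _.
rewrite exprS -mulrA ler_wpM2l // subr_ge0 invf_le1 ?mulr_gt0 ?ltr0n //.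
  by rewrite -[leLHS]mulr1 ler_pM ?ler1n.
exact: lt_le_trans C_ge1.
Qed.

End Gap.
End Glauber.

From mathcomp Require Import all_classical all_reals all_analysis.

Import Order.TTheory GRing.Theory Num.Theory.
Import numFieldNormedType.Exports.

(** * Derivatives and a Gronwall inequality *)

Section Derive.
Variable R : realType.

Lemma is_derive_bigsum (J : finType) (P : pred J) (h : J -> R -> R) (dh : J -> R) (x : R) :
  (forall i, P i -> is_derive x 1 (h i) (dh i)) ->
  is_derive x 1 (fun t => \sum_(i | P i) h i t) (\sum_(i | P i) dh i).
Proof.
move=> H.
have -> : (fun t => \sum_(i | P i) h i t) = \sum_(i | P i) h i.
  by apply/funext => t; rewrite fct_sumE.
elim/big_ind2 : _ => //; first exact: is_derive_cst.
by move=> f df g dg Hf Hg; exact: is_deriveD.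
Qed.

Lemma is_derive_pow (f : R -> R) (x df : R) n : is_derive x 1 f df ->
  is_derive x 1 (fun t => f t ^+ n) (n%:R * f x ^+ n.-1 * df).
Proof. by move=> D; have := is_deriveX n D; rewrite exprfctE. Qed.

Lemma is_derive_mul (f g : R -> R) (x df dg : R) :
  is_derive x 1 f df -> is_derive x 1 g dg ->
  is_derive x 1 (fun t => f t * g t) (f x * dg + g x * df).
Proof. exact: is_deriveM. Qed.

Lemma is_derive_monomial (c x : R) n :
  is_derive x 1 (fun t => c * t ^+ n) (c * (n%:R * x ^+ n.-1)).
Proof.
have D : is_derive x 1 (fun t => c * t ^+ n) _ :=
  is_deriveM (is_derive_cst c x 1) (is_derive_pow n (is_derive_id x (1 : R))).
apply: (is_derive_eq D).
by rewrite /GRing.scale /= mulr0 addr0 mulr1.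
Qed.

Lemma is_derive_onem_exp (x : R) n :
  is_derive x 1 (fun t => (1 - t) ^+ n) (- (n%:R * (1 - x) ^+ n.-1)).
Proof.
have D : is_derive x 1 (fun t => (1 - t) ^+ n) _ :=
  is_derive_pow n (is_deriveB (is_derive_cst (1 : R) x 1) (is_derive_id x (1 : R))).
apply: (is_derive_eq D).
by rewrite /GRing.scale /= sub0r mulrN1.
Qed.

(** The integrating factor [t^-a * expR (- b * t)] makes [psi] nonincreasing on [[x, y]]. *)
Lemma gronwall_power (U U' : R -> R) (a : nat) (b x y : R) : 0 < x -> x <= y ->
  (forall t, x <= t <= y -> is_derive t 1 U (U' t)) ->
  (forall t, x <= t <= y -> U' t <= (a%:R / t + b) * U t) ->
  U y <= (y / x) ^+ a * expR (b * (y - x)) * U x.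
Proof.
move=> x0 xy dU leU.
pose psi t := U t * (t ^- a * expR (- b * t)).
have dpsi t : x <= t <= y -> is_derive t 1 psi ((t ^- a * expR (- b * t)) * (U' t - (a%:R / t + b) * U t)).
  move=> txy; have t0 : 0 < t by case/andP: txy => /(lt_le_trans x0).
  have tn0 : t != 0 by rewrite gt_eqF.
  have tan0 : t ^+ a != 0 by rewrite expf_neq0.
  have := dU t txy => dUt.
  have aE : (t ^+ a) ^- 2 * (a%:R * t ^+ a.-1) = t ^- a * (a%:R / t).
    case: (a) tan0 => [|k] tk0; first by rewrite !mul0r !mulr0.
    move: tk0; rewrite exprS /=; move: (t ^+ k) (k.+1%:R) => p c.
    by rewrite mulf_eq0 negb_or => /andP[_ p0]; field; rewrite tn0 p0.
  have dX : is_derive t 1 (fun t => t ^- a) (- (t ^- a * (a%:R / t))).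
    have D : is_derive t 1 (fun t => t ^- a) _ :=
      @is_deriveV _ (fun t => t ^+ a) t _ 1 tan0 (is_derive_pow a (is_derive_id t (1 : R))).
    apply: (is_derive_eq D).
    by rewrite /GRing.scale /= mulr1 mulNr aE.
  have dE : is_derive t 1 (fun t => expR (- b * t)) (expR (- b * t) * (- b)).
    have D : is_derive t 1 (fun t => expR (- b * t)) _ :=
      is_derive1_comp (is_derive_expR (- b * t))
        (is_deriveM (is_derive_cst (- b) t 1) (is_derive_id t (1 : R))).
    apply: (is_derive_eq D).
    by rewrite /GRing.scale /= mulr0 addr0 mulr1.
  have D : is_derive t 1 psi _ := is_derive_mul dUt (is_derive_mul dX dE).
  apply: (is_derive_eq D).
  ring.
have : psi y <= psi x.
  apply: (@ler0_derive1_nincr _ psi x y) => //.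
  - by move=> t; rewrite in_itv /= => /andP[? ?]; have /dpsi[] : x <= t <= y by rewrite !ltW.
  - move=> t; rewrite in_itv /= => /andP[? ?].
    have txy : x <= t <= y by rewrite !ltW.
    have t0 : 0 < t by apply: lt_trans x0 _.
    rewrite derive1E; have [_ ->] := dpsi t txy.
    by rewrite mulr_ge0_le0 ?subr_le0 ?leU // mulr_ge0 ?expR_ge0 // invr_ge0 exprn_ge0 // ltW.
  - by apply: derivable_within_continuous => t; rewrite in_itv /= => /dpsi[].
rewrite /psi => H.
have y0 : 0 < y by apply: lt_le_trans xy.
have cy : 0 < y ^- a * expR (- b * y) by rewrite mulr_gt0 ?expR_gt0 // invr_gt0 exprn_gt0.
rewrite -(ler_pM2r cy); apply: le_trans H _.
rewrite le_eqVlt; apply/orP; left; apply/eqP.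
have -> : expR (- b * x) = expR (b * (y - x)) * expR (- b * y).
  by rewrite -expRD; congr expR; ring.
have : x ^+ a != 0 by rewrite expf_neq0 ?gt_eqF.
have : y ^+ a != 0 by rewrite expf_neq0 ?gt_eqF.
rewrite expr_div_n; move: (x ^+ a) (y ^+ a) (expR _) (expR _) => p q r1 r2 q0 p0.
by field; rewrite p0 q0.
Qed.
End Derive.

(** * The Poincare inequality *)

Section FieldDynamics.
Variables (R : realType) (T : finType) (I : pred {set T}).
Hypothesis I_down : forall X Y : {set T}, X \subset Y -> I Y -> I X.
Variable h : {set T} -> R.
Implicit Types (S X : {set T}) (t x : R) (e : T).

Local Notation Z := (link_mass I).
Local Notation F := (link_sum I h).
Local Notation V := (link_var I h).
Local Notation m := (link_mean I h).

(* Up to the factor #|I|, the expected conditional variance of h given the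
   revealed set, for the uniform distribution on I. *)
Definition revealed_var t : R := \sum_(S | I S) (1 - t) ^+ #|S| * V t S.

Definition edge_energy : R :=
  \sum_(S | I S) \sum_(e in ~: S) if I (e |: S) then (h (e |: S) - h S) ^+ 2 else 0.

Lemma is_derive_link_sum (g : {set T} -> R) x S :
  is_derive x 1 (fun t => link_sum I g t S) (\sum_(e in ~: S) link_sum I g x (e |: S)).
Proof.
rewrite -link_sum_deriv.
by apply: is_derive_bigsum => X _; exact: is_derive_monomial.
Qed.

(** Each summand is the second moment of [h] about [m x S] in the link of [e |: S]: the variance
    there plus the squared shift of the mean. *)
Lemma is_derive_link_var x S : 0 < x -> I S ->
  is_derive x 1 (fun t => V t S)
    (\sum_(e in ~: S) (link_sum I (fun X => h X ^+ 2) x (e |: S)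
       - 2 * m x S * F x (e |: S) + m x S ^+ 2 * Z x (e |: S))).
Proof.
move=> x0 IS; have Z0 := link_mass_gt0 x0 IS.
have Zn0 : Z x S != 0 by rewrite gt_eqF.
have dZ : is_derive x 1 (fun t => (Z t S)^-1) _ :=
  @is_deriveV _ (fun t => Z t S) x _ 1 Zn0 (is_derive_link_sum (fun=> 1) x S).
have dF := is_derive_mul (is_derive_pow 2 (is_derive_link_sum h x S)) dZ.
have D : is_derive x 1 (fun t => V t S) _ :=
  is_deriveB (is_derive_link_sum (fun X => h X ^+ 2) x S) dF.
apply: (is_derive_eq D).
rewrite big_split sumrB /= -!mulr_sumr /GRing.scale /= expr1 /m /link_mean -/(Z _ _).
by field.
Qed.

Definition revealed_var_deriv t : R :=
  \sum_(S | I S) (1 - t) ^+ #|S| *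
    \sum_(e in ~: S) Z t (e |: S) * (m t (e |: S) - m t S) ^+ 2.

(** Differentiating [(1 - t) ^+ #|S|] gives, after [sum_link_mem], minus the variances of the links
    of [e |: S]. They cancel those in [is_derive_link_var], and only the shifts of the mean
    survive. *)
Lemma is_derive_revealed_var x : 0 < x ->
  is_derive x 1 revealed_var (revealed_var_deriv x).
Proof.
move=> x0.
have D : is_derive x 1 revealed_var _ := is_derive_bigsum (fun S IS =>
  is_derive_mul (is_derive_onem_exp x #|S|) (is_derive_link_var x0 IS)).
apply: (is_derive_eq D); rewrite big_split /=.
have -> : \sum_(S | I S) V x S * - (#|S|%:R * (1 - x) ^+ #|S|.-1) =
    - \sum_(S | I S) (1 - x) ^+ #|S| * \sum_(e in ~: S) V x (e |: S).
  rewrite -sumrN.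
  transitivity (\sum_(S | I S) \sum_(e in S) - (V x S * (1 - x) ^+ #|S|.-1)).
    apply: eq_bigr => S _; rewrite sumr_const -mulr_natl; ring.
  rewrite (sum_link_mem I_down (fun S => - (V x S * (1 - x) ^+ #|S|.-1))).
  apply: eq_bigr => S _; rewrite -mulrN -sumrN mulr_sumr; apply: eq_bigr => e.
  rewrite inE => eS; case: ifPn => [_|NI]; first by rewrite cardsU1 eS /=; ring.
  by rewrite /link_var !(link_sum_notin I_down) // expr0n mul0r subr0 oppr0 mulr0.
rewrite -sumrB; apply: eq_bigr => S IS; rewrite -mulrBr -sumrB; congr (_ * _).
apply: eq_bigr => e _; have [IeS|NI] := boolP (I (e |: S)); last first.
  by rewrite /link_var /link_mass !(link_sum_notin I_down) // expr0n !(mul0r, mulr0, subr0, addr0).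
have Z0 := link_mass_gt0 x0 IS; have Ze0 := link_mass_gt0 x0 IeS.
by rewrite /link_var /m /link_mean; field; rewrite !gt_eqF.
Qed.

(** At 1 only the empty set keeps a nonzero weight, as [0 ^+ 0 = 1]. If [I] omits the empty set, [I]
    itself is empty and both sides are 0. *)
Lemma revealed_var1 :
  revealed_var 1 = \sum_(X | I X) h X ^+ 2 - (\sum_(X | I X) h X) ^+ 2 / #|I|%:R.
Proof.
have E (g : {set T} -> R) : link_sum I g 1 finset.set0 = \sum_(X | I X) g X.
  by apply: eq_big => [X|X _]; rewrite ?finset.sub0set ?andbT // expr1n mulr1.
have [I0|NI0] := boolP (I finset.set0).
  rewrite /revealed_var (bigD1 finset.set0) //= big1 ?addr0 => [|S /andP[_ S0]].
    by rewrite cards0 expr0 mul1r /link_var /link_mass !E sumr_const.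
  by rewrite subrr expr0n cards_eq0 (negPf S0) mul0r.
have N X : I X = false.
  by apply: contraNF NI0 => /(I_down (finset.sub0set X)).
by rewrite /revealed_var !big1 => [|X|X|X]; rewrite ?N // expr0n mul0r subr0.
Qed.

(** The variance is at most the second moment about [h S]. There [X = S] contributes nothing, one
    extra element costs a factor [t], and more cost at most [t ^+ 2]. *)
Lemma link_var_small t S : 0 < t <= 1 -> I S ->
  V t S <= t * (\sum_(e in ~: S) if I (e |: S) then (h (e |: S) - h S) ^+ 2 else 0)
           + t ^+ 2 * \sum_X (h X - h S) ^+ 2.
Proof.
move=> /andP[t0 t1] IS; have Z0 := link_mass_gt0 t0 IS.
pose g X := (h X - h S) ^+ 2.
apply: (@le_trans _ _ (link_sum I g t S)).
  rewrite -subr_ge0.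
  have -> : link_sum I g t S - V t S = (m t S - h S) ^+ 2 * Z t S.
    have -> : link_sum I g t S = link_sum I (fun X => h X ^+ 2) t S
        - 2 * h S * F t S + h S ^+ 2 * Z t S.
      rewrite /link_mass /link_sum !mulr_sumr -sumrN -!big_split.
      by apply: eq_bigr => X _ /=; rewrite /g; ring.
    by rewrite /link_var /m /link_mean; field; rewrite gt_eqF.
  by rewrite mulr_ge0 ?sqr_ge0 // ltW.
have pw X : I X && (S \subset X) -> g X * t ^+ #|X :\: S| <=
   \sum_(e in ~: S) (if X == e |: S then t * g X else 0) + t ^+ 2 * g X.
  move=> /andP[IX SX]; have g0 : 0 <= g X by exact: sqr_ge0.
  have s0 : 0 <= \sum_(e in ~: S) (if X == e |: S then t * g X else 0).
    by apply: sumr_ge0 => e _; case: ifP => // _; rewrite mulr_ge0 // ltW.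
  have [|n1] := boolP (#|X :\: S| == 1%N).
    move=> /cards1P[e XS]; have eS : e \in ~: S.
      have : e \in X :\: S by rewrite XS set11.
      by rewrite !inE => /andP[].
    have XE : X = e |: S by rewrite -XS -{1}(finset.setID X S) (finset.setIidPr SX) finset.setUC.
    rewrite (bigD1 e) //= {3}XE eqxx XS cards1 expr1 mulrC -addrA lerDl addr_ge0 //.
      by apply: sumr_ge0 => i _; case: ifP => // _; rewrite mulr_ge0 // ltW.
    by rewrite mulr_ge0 // exprn_ge0 // ltW.
  apply: le_trans (_ : t ^+ 2 * g X <= _); last by rewrite lerDr.
  rewrite mulrC; case: (#|X :\: S|) (cards_eq0 (X :\: S)) n1 => [|[|k]] // E _.
    have XS : X = S.
      by apply/eqP; rewrite finset.eqEsubset SX andbT -finset.setD_eq0 -E.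
    by rewrite /g XS subrr expr0n !mulr0.
  by rewrite ler_wpM2r // -addn2 exprD ler_piMl ?exprn_ge0 ?exprn_ile1 // ltW.
apply: (@le_trans _ _ (\sum_(X | I X && (S \subset X))
  (\sum_(e in ~: S) (if X == e |: S then t * g X else 0) + t ^+ 2 * g X))).
  by apply: ler_sum => X; exact: pw.
rewrite big_split /= lerD //.
  rewrite exchange_big /= mulr_sumr; apply: ler_sum => e eS.
  rewrite -big_mkcondr /=; have [IeS|NI] := ifPn.
    rewrite (big_pred1 (e |: S)) // => X; rewrite /= andbC.
    by case: eqP => // ->; rewrite IeS finset.subsetUr.
  rewrite big1 ?mulr0 // => X /andP[/andP[IX _] /eqP XE].
  by rewrite -XE IX in NI.
rewrite mulr_sumr big_mkcond; apply: ler_sum => X _; case: ifP => // _.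
by rewrite mulr_ge0 ?sqr_ge0.
Qed.

Lemma revealed_var_small : exists c : R, 0 <= c /\ forall t, 0 < t <= 1 ->
  revealed_var t <= t * (edge_energy + t * c).
Proof.
exists (\sum_(S | I S) \sum_X (h X - h S) ^+ 2); split.
  by apply: sumr_ge0 => S _; apply: sumr_ge0 => X _; exact: sqr_ge0.
move=> t t01; have /andP[t0 t1] := t01.
rewrite mulrDr mulrA -expr2 /edge_energy !mulr_sumr -big_split.
apply: ler_sum => S IS.
have le1 : (1 - t) ^+ #|S| <= 1 by rewrite exprn_ile1 ?subr_ge0 // gerBl ltW.
have ge0 : 0 <= (1 - t) ^+ #|S| by rewrite exprn_ge0 ?subr_ge0.
apply: le_trans (ler_wpM2l ge0 (link_var_small t01 IS)) _.
apply: ler_piMl le1; apply: addr_ge0; apply: mulr_ge0; rewrite ?sqr_ge0 ?(ltW t0) //.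
  by apply: sumr_ge0 => e _; case: ifP => // _; exact: sqr_ge0.
by apply: sumr_ge0 => e _; exact: sqr_ge0.
Qed.

Lemma revealed_var_deriv_le (K : R) t : 0 < t <= 1 -> 0 < K ->
  (forall S e, I S -> e \notin S -> I (e |: S) ->
     \sum_(e' in ~: S) `|link_prob I t (e |: S) e' - link_prob I t S e'| <= K) ->
  revealed_var_deriv t <= K / t * revealed_var t.
Proof.
move=> /andP[t0 t1] K0 infl; rewrite /revealed_var_deriv mulr_sumr.
apply: ler_sum => S IS; rewrite mulrCA ler_wpM2l ?exprn_ge0 ?subr_ge0 //.
by apply: influence_link_var => // e; exact: infl.
Qed.

(** Gronwall on [[x, 1]] with rate [a / t] gives the factor [x^-a]. On [[y, x]] with rate
    [1 / t + b] it gives at most [x / y * expR (b * x)]; as [y] tends to 0, [revealed_var_small]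
    turns [revealed_var y / y] into the energy. *)
Lemma poincare (a : nat) (b x : R) : 0 < x <= 1 -> 0 <= b -> (0 < a)%N ->
  (forall t S e, 0 < t <= 1 -> I S -> e \notin S -> I (e |: S) ->
     \sum_(e' in ~: S) `|link_prob I t (e |: S) e' - link_prob I t S e'| <= 1 + b * t) ->
  (forall t S e, 0 < t <= 1 -> I S -> e \notin S -> I (e |: S) ->
     \sum_(e' in ~: S) `|link_prob I t (e |: S) e' - link_prob I t S e'| <= a%:R) ->
  \sum_(X | I X) h X ^+ 2 - (\sum_(X | I X) h X) ^+ 2 / #|I|%:R <=
  x ^- a.-1 * expR (b * x) * edge_energy.
Proof.
move=> /andP[x0 x1] b0 a0 infl1 infl2; rewrite -revealed_var1.
have up : revealed_var 1 <= x ^- a * revealed_var x.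
  have := @gronwall_power R revealed_var revealed_var_deriv a 0 x 1 x0 x1.
  rewrite mul0r expR0 mulr1 div1r exprVn; apply => t /andP[xt t1].
    by apply: is_derive_revealed_var; exact: lt_le_trans xt.
  have t0 : 0 < t by exact: lt_le_trans xt.
  rewrite addr0; apply: revealed_var_deriv_le; rewrite ?t0 ?ltr0n // => S e.
  by apply: infl2; rewrite t0.
have energy_ge0 : 0 <= edge_energy.
  by apply: sumr_ge0 => S _; apply: sumr_ge0 => e _; case: ifP => // _; exact: sqr_ge0.
have low : revealed_var x <= x * expR (b * x) * edge_energy.
  have [c [c0 small]] := revealed_var_small.
  have xe0 : 0 < x * expR (b * x) by rewrite mulr_gt0 ?expR_gt0.
  rewrite -ler_pdivrMl //; apply/ler_addgt0Pr => eps eps0.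
  (* Small enough for the error [y * c] of [revealed_var_small] to be at most [eps]; [c + 1] avoids
     dividing by 0. *)
  pose y := Num.min x (eps / (c + 1)).
  have c10 : 0 < c + 1 by rewrite ltr_pwDr.
  have y0 : 0 < y by rewrite lt_min x0 divr_gt0.
  have yx : y <= x by rewrite ge_min lexx.
  have y1 : y <= 1 by exact: le_trans x1.
  have := @gronwall_power R revealed_var revealed_var_deriv 1 b y x y0 yx.
  have : y * c <= eps.
    apply: (@le_trans _ _ (eps / (c + 1) * (c + 1))); last by rewrite divfK // gt_eqF.
    by apply: ler_pM => //; rewrite ?(ltW y0) ?lerDl // ge_min lexx orbT.
  move=> yc H; rewrite ler_pdivrMl //.
  apply: le_trans (H _ _) _ => [t /andP[yt tx]|t /andP[yt tx]|].
  - by apply: is_derive_revealed_var; exact: lt_le_trans yt.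
  - have t0 : 0 < t by exact: lt_le_trans yt.
    have -> : 1%:R / t + b = (1 + b * t) / t by field; rewrite gt_eqF.
    have t1 : t <= 1 by exact: le_trans x1.
    have K0 : 0 < 1 + b * t by rewrite ltr_pwDl // mulr_ge0 // ltW.
    apply: revealed_var_deriv_le => // [|S e]; first by rewrite t0.
    by apply: infl1; rewrite t0.
  - have yy : 0 < y <= 1 by rewrite y0.
    have := small y yy; rewrite expr1 => sy.
    have R0 : 0 <= x / y * expR (b * (x - y)).
      by rewrite !mulr_ge0 ?expR_ge0 ?invr_ge0 ?(ltW x0) ?(ltW y0).
    apply: le_trans (ler_wpM2l R0 sy) _.
    have -> : x / y * expR (b * (x - y)) * (y * (edge_energy + y * c)) =
      x * expR (b * (x - y)) * (edge_energy + y * c) by field; rewrite gt_eqF.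
    apply: ler_pM; rewrite ?mulr_ge0 ?addr_ge0 ?expR_ge0 ?mulr_ge0 ?(ltW x0) ?(ltW y0) //.
      by rewrite (ler_wpM2l (ltW x0)) // ler_expR ler_wpM2l // gerBl ltW.
    by rewrite lerD2l.
apply: le_trans up _.
apply: (@le_trans _ _ (x ^- a * (x * expR (b * x) * edge_energy))).
  by rewrite ler_wpM2l // invr_ge0 exprn_ge0 // ltW.
rewrite le_eqVlt; apply/orP; left; apply/eqP.
case: a a0 {infl2} => [//|a] _; rewrite exprS /=.
have : x ^+ a != 0 by rewrite expf_neq0 ?gt_eqF.
by move: (x ^+ a) => p p0; field; rewrite p0 gt_eqF.
Qed.

End FieldDynamics.

(** * Mixing times *)

Section MixingBound.
Variables (R : realType) (G : sgraph).
Implicit Types (pi f : matching G -> R).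

(* The value of the constant in [poincare] at x = 1/s^2, a = 5 + 4s and
   b = 2 s^2; the leading 4 comes from [energy_le]. *)
Definition gap_const (s : nat) : R := 4 * ((s ^ 2)%:R ^+ (4 + 4 * s) * expR 2).

Lemma gap_const_ge1 s : (0 < s)%N -> 1 <= gap_const s.
Proof.
move=> s0; rewrite /gap_const.
have h1 : 1 <= (s ^ 2)%:R ^+ (4 + 4 * s) :> R by rewrite exprn_ege1 // ler1n expn_gt0 s0.
have h2 : 1 <= expR 2 :> R by rewrite -expR0 ler_expR.
move: (_ ^+ (4 + 4 * s)) (expR 2) h1 h2 => x y x1 y1.
by have := ler_pM ler01 ler01 x1 y1; rewrite mulr1; lra.
Qed.

Lemma matching_poincare (s : nat) f : (0 < s)%N -> (max_degree G <= s ^ 2)%N ->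
  \sum_M f M = 0 ->
  \sum_M f M ^+ 2 <=
    gap_const s * \sum_(e in edges G) \sum_M f M * (f M - average e f M).
Proof.
move=> s0 degs f0.
have s2 : 0 < (s ^ 2)%:R :> R by rewrite ltr0n expn_gt0 s0.
pose D : R := (s ^ 2)%:R.
have x01 : 0 < D^-1 <= 1 by rewrite invr_gt0 s2 invf_le1 // ler1n expn_gt0 s0.
have b0 : 0 <= 2 * D by rewrite mulr_ge0 // ltW.
have := @poincare R _ (@is_matching G) (@matching_down G) (extend f) (5 + 4 * s) (2 * D) D^-1 x01 b0 isT.
have -> : \sum_(X | is_matching X) extend f X ^+ 2 = \sum_M f M ^+ 2.
  by rewrite sum_matching; apply: eq_bigr => M _; rewrite extend_val.
have -> : \sum_(X | is_matching X) extend f X = 0.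
  by rewrite sum_matching -[RHS]f0; apply: eq_bigr => M _; rewrite extend_val.
rewrite expr0n mul0r subr0 => H; apply: le_trans (H _ _) _.
- move=> t S e /andP[t0 t1] mS eS meS.
  (* [1 + 2 B] with [B = t * s^2], from [removal_influence_small]. *)
  have -> : 2 * D * t = 2 * (t * D) by ring.
  by apply: link_influence_le => // A u uA; exact: removal_influence_small.
- move=> t S e /andP[t0 t1] mS eS meS.
  (* [1 + 2 B] with [B = 2 (1 + s)], from [removal_influence_sqrt]. *)
  have -> : (5 + 4 * s)%:R = 1 + 2 * (2 * (1 + s%:R)) :> R by rewrite natrD natrM; ring.
  by apply: link_influence_le => // A u uA; exact: removal_influence_sqrt.
rewrite -exprVn invrK [2 * D / D]mulfK ?gt_eqF //.
have -> : (5 + 4 * s).-1 = (4 + 4 * s)%N by [].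
rewrite /gap_const -/D; set c := D ^+ _ * expR 2.
have c0 : 0 <= c by rewrite mulr_ge0 ?expR_ge0 // exprn_ge0 // ltW.
by apply: le_trans (ler_wpM2l c0 (energy_le f)) _; rewrite mulrA [c * 4]mulrC.
Qed.

(** [chi] bounds the chi-square distance of [pi] from uniform. Once [t] exceeds
    [gap_const s * m * ln (4 * chi)] that distance is at most 1/4, so by Cauchy-Schwarz the
    l1-distance is at most 1/2. The added 1 comes from rounding [t] up. *)
Lemma mixing_time_le (s : nat) pi (chi : R) : (0 < s)%N -> (max_degree G <= s ^ 2)%N ->
  (0 < size_of G)%N -> is_distr pi -> 1 <= chi ->
  #|matching G|%:R * \sum_M deviation pi M ^+ 2 <= chi ->
  (mixing_time pi <= (gap_const s * (size_of G)%:R * ln (4 * chi) + 1)%:E)%E.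
Proof.
move=> s0 degs m0 [pi_ge0 pi1] chi1 devle.
set C := gap_const s; set m := (size_of G)%:R.
have C1 : 1 <= C := gap_const_ge1 s0.
have C0 : 0 < C by exact: lt_le_trans C1.
have mr1 : 1 <= m by rewrite ler1n.
have mr0 : 0 < m by exact: lt_le_trans mr1.
have Cm0 : 0 < C * m by rewrite mulr_gt0.
have chi0 : 0 < chi by exact: lt_le_trans chi1.
have L0 : 0 <= ln (4 * chi) by rewrite ln_ge0 //; lra.
pose x := C * m * ln (4 * chi).
have x0 : 0 <= x by rewrite mulr_ge0 // ltW.
pose t := (Num.truncn x).+1.
have xt : x < t%:R by exact: truncnS_gt.
apply: (@le_trans _ _ (t%:R)%:E); last first.
  by rewrite lee_fin -/x /t -natr1 lerD2r truncn_le.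
apply: ereal_inf_lbound; exists t => //=.
have [_ Hdev] := deviation_iter C1 (fun f => @matching_poincare s f s0 degs) t m0 pi1.
set d := deviation _ in Hdev.
have n0 : 0 < #|matching G|%:R :> R by rewrite ltr0n card_matching_gt0.
have gap : (1 - (C * m)^-1) ^+ t * (4 * chi) <= 1.
  have g0 : 0 <= 1 - (C * m)^-1.
    by rewrite subr_ge0 invf_le1 // -[leLHS]mulr1 ler_pM.
  have h : (1 - (C * m)^-1) ^+ t <= expR (- ln (4 * chi)).
    apply: (@le_trans _ _ (expR (- (C * m)^-1) ^+ t)).
      by rewrite ler_pXn2r ?nnegrE ?expR_ge0 // expR_ge1Dx.
    rewrite -expRM_natl ler_expR mulrN lerN2 ler_pdivlMr //.
    by rewrite mulrC ltW.
  have c4 : 0 < 4 * chi by rewrite mulr_gt0.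
  by move: h; rewrite expRN lnK ?posrE // -ler_pdivlMr // mul1r.
have key : (\sum_M `|d M|) ^+ 2 <= 2^-1 ^+ 2.
  apply: le_trans (sqr_sum_le predT _) _.
  under [X in _ * X]eq_bigr do rewrite real_normK ?num_real //.
  apply: le_trans (ler_wpM2l (ltW n0) Hdev) _.
  rewrite mulrCA; apply: le_trans (ler_wpM2l _ devle) _.
    by rewrite exprn_ge0 // subr_ge0 invf_le1 // -[leLHS]mulr1 ler_pM.
  by move: (_ ^+ t) gap => g; clear; lra.
rewrite /tv_dist.
have s1 : \sum_M `|d M| <= 2^-1.
  by rewrite -(ler_pXn2r (n:=2)) ?nnegrE ?sumr_ge0.
have : \sum_M `|iter t (@glauber_step R G) pi M - monomer_dimer R G M| = \sum_M `|d M| by [].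
by move=> ->; move: (\sum_M _) s1 => S; clear; lra.
Qed.

End MixingBound.

(** * Point masses and warm starts *)

Section Starts.
Variables (R : realType) (G : sgraph).
Implicit Types (pi f : matching G -> R) (M : matching G).

Lemma size_le_order : (size_of G <= order_of G * max_degree G)%N.
Proof.
rewrite /size_of /edges; apply: leq_trans (leq_imset_card _ _) _.
have -> : #|[pred p : vertex G * vertex G | adj p.1 p.2]| = (\sum_(v : vertex G) degree v)%N.
  rewrite -sum1_card (eq_bigl (fun p : vertex G * vertex G => true && adj p.1 p.2)) //.
  rewrite -(pair_big_dep predT (fun v w : vertex G => adj v w) (fun _ _ => 1%N)) /=.
  by apply: eq_bigr => v _; rewrite sum1_card /degree cardsE.
rewrite /order_of -sum_nat_const; apply: leq_sum => v _; exact: leq_bigmax.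
Qed.

Lemma card_matching_le : (#|matching G| <= 2 ^ size_of G)%N.
Proof.
rewrite /size_of -card_powerset -cardsT -(card_imset _ val_inj).
apply/subset_leq_card/fintype.subsetP => X /imsetP[M _ ->].
by have /andP[ME _] := valP M; rewrite powersetE.
Qed.

Lemma sum_deviation_sqr pi : \sum_M pi M = 1 ->
  #|matching G|%:R * \sum_M deviation pi M ^+ 2 <= #|matching G|%:R * \sum_M pi M ^+ 2.
Proof.
move=> pi1; have n0 : 0 < #|matching G|%:R :> R by rewrite ltr0n card_matching_gt0.
rewrite ler_pM2l //.
have -> : \sum_M deviation pi M ^+ 2 = \sum_M pi M ^+ 2 - #|matching G|%:R^-1.
  rewrite (eq_bigr (fun M => pi M ^+ 2 - 2 * #|matching G|%:R^-1 * pi M + #|matching G|%:R^-1 ^+ 2)).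
    rewrite big_split sumrB /= -mulr_sumr pi1 sumr_const -[_^-1 ^+ 2 *+ _]mulr_natl.
    by field; rewrite gt_eqF.
  by move=> M _; rewrite /deviation /monomer_dimer; ring.
by rewrite gerBl invr_ge0 ltW.
Qed.

Lemma point_mass_distr M : is_distr (point_mass R M).
Proof.
split=> [N|]; first by rewrite /point_mass ler0n.
by rewrite (bigD1 M) //= /point_mass eqxx big1 ?addr0 // => N /negPf->.
Qed.

Lemma mixing_time_edgeless pi : size_of G = 0%N -> is_distr pi -> (mixing_time pi <= 0)%E.
Proof.
move=> m0 [_ pi1]; apply: ereal_inf_lbound; exists 0%N => //=.
have c1 : #|matching G| = 1%N.
  apply/eqP; rewrite eqn_leq card_matching_gt0 andbT.
  by have := card_matching_le; rewrite m0.
have [M0 M0E] : exists M0 : matching G, forall M, M = M0.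
  have /card_le1_eqP H : (#|matching G| <= 1)%N by rewrite c1.
  by have /card_gt0P[M0 _] := card_matching_gt0 G; exists M0 => M; exact: H.
have piE M : pi M = 1 by rewrite -pi1 (M0E M) (bigD1 M0) //= big1 ?addr0 // => N; rewrite (M0E N) eqxx.
rewrite /tv_dist big1 ?mulr0 ?invr_ge0 // => M _.
by rewrite piE /monomer_dimer c1 invr1 subrr normr0.
Qed.

(** A point mass has chi-square distance at most the number of matchings, hence at most [2^m], and
    [ln (4 * 2^m) <= 3 m]. One of the two factors [m] is then replaced by [s^2 n]; the constant 4
    absorbs the rounding. *)
Lemma worst_mixing_time_le (s : nat) : (0 < s)%N -> (max_degree G <= s ^ 2)%N ->
  (worst_mixing_time R G <=
    (4 * gap_const R s * (s ^ 2)%:R * (order_of G)%:R * (size_of G)%:R)%:E)%E.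
Proof.
move=> s0 degs; apply: ge_ereal_sup => _ [M _ <-].
have g1 := gap_const_ge1 R s0.
have [m0|m0] := posnP (size_of G).
  rewrite m0 mulr0; apply: mixing_time_edgeless => //; exact: point_mass_distr.
have [pi_ge0 pi1] := point_mass_distr M.
have n1 : (1 : R) <= 2 ^+ size_of G by rewrite exprn_ege1 // ler1n.
apply: le_trans (mixing_time_le s0 degs m0 (point_mass_distr M) n1 _) _.
  apply: le_trans (sum_deviation_sqr pi1) _.
  rewrite (bigD1 M) //= big1 => [|N /negPf NM]; last by rewrite /point_mass NM expr0n.
  by rewrite /point_mass eqxx expr1n addr0 mulr1 -natrX ler_nat card_matching_le.
rewrite lee_fin.
have mr1 : 1 <= (size_of G)%:R :> R by rewrite ler1n.
have l2 : ln (2 : R) <= 1 by have := @le_ln1Dx R 1; apply; rewrite (lt_trans _ ltr01) // ltrN10.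
have lE : ln (4 * 2 ^+ size_of G : R) <= 3 * (size_of G)%:R.
  have -> : 4 * 2 ^+ size_of G = 2 ^+ (size_of G + 2) :> R by rewrite exprD mulrC expr2; congr (_ * _); ring.
  rewrite lnXn // -[_ *+ _]mulr_natl natrD.
  apply: (@le_trans _ _ (((size_of G)%:R + 2) * 1)); first by rewrite ler_wpM2l.
  by rewrite mulr1; move: mr1; clear; lra.
have mn : (size_of G)%:R <= (s ^ 2)%:R * (order_of G)%:R :> R.
  rewrite -natrM ler_nat; apply: leq_trans size_le_order _.
  by rewrite mulnC leq_mul2r degs orbT.
move: g1 mr1 lE mn; move: (gap_const R s) (size_of G)%:R (ln _) (s ^ 2)%:R (order_of G)%:R => g m l s2 n.
clear; move=> g1 m1 lm mn.
have gm1 : 1 <= g * m by rewrite -[leLHS]mulr1 ler_pM.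
have gm0 : 0 <= g * m by exact: le_trans gm1.
apply: (@le_trans _ _ (4 * (g * m) * m)).
  apply: (@le_trans _ _ (g * m * (3 * m) + 1)); first by rewrite lerD2r ler_wpM2l.
  have := ler_wpM2l gm0 m1; lra.
have := ler_wpM2l gm0 mn; lra.
Qed.

(** A density bounded by [c] has mean square at most [c], since its mean is 1. That [c >= 1], which
    the logarithm requires, is Cauchy-Schwarz. *)
Lemma warm_mixing_time_le (s : nat) pi (c : R) : (0 < s)%N -> (max_degree G <= s ^ 2)%N ->
  (0 < size_of G)%N -> is_distr pi ->
  (forall M, pi M / monomer_dimer R G M <= c) ->
  1 <= c /\
  (mixing_time pi <= (gap_const R s * (size_of G)%:R * ln (4 * c) + 1)%:E)%E.
Proof.
move=> s0 degs m0 dpi warm; have [pi_ge0 pi1] := dpi.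
have le_c : #|matching G|%:R * \sum_M pi M ^+ 2 <= c.
  have -> : c = c * \sum_M pi M by rewrite pi1 mulr1.
  rewrite !mulr_sumr; apply: ler_sum => M _.
  rewrite expr2 mulrA ler_wpM2r // mulrC.
  by have := warm M; rewrite /monomer_dimer invrK.
have c1 : 1 <= c.
  apply: le_trans le_c; have : (\sum_M pi M) ^+ 2 <=
    #|matching G|%:R * \sum_M pi M ^+ 2 := sqr_sum_le predT pi.
  by rewrite pi1 expr1n.
split=> //; apply: mixing_time_le => //.
by apply: le_trans le_c; exact: sum_deviation_sqr.
Qed.

End Starts.

Local Open Scope classical_set_scope.

(** * The gap constant is a subpolynomial factor *)

Section Asymptotics.
Variable R : realType.

(** [ln x] is twice the logarithm of [sqrt x], hence below [2 * sqrt x], and [2 <= eps * sqrt x] on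
    this range. *)
Lemma ln_le_eps (eps x : R) : 0 < eps -> 4 / eps ^+ 2 <= x -> ln x <= eps * x.
Proof.
move=> e0 hx; have e2 : 0 < eps ^+ 2 by rewrite exprn_gt0.
have x0 : 0 < x by apply: lt_le_trans hx; rewrite divr_gt0.
have r0 : 0 < Num.sqrt x by rewrite sqrtr_gt0.
have xE : x = Num.sqrt x ^+ 2 by rewrite sqr_sqrtr // ltW.
have rE : 2 <= eps * Num.sqrt x.
  have er0 : 0 <= eps * Num.sqrt x by rewrite mulr_ge0 // ltW.
  rewrite -(@ler_pXn2r _ 2) ?nnegrE //.
  by rewrite exprMn -xE mulrC -ler_pdivrMr // (_ : 2 ^+ 2 = 4 :> R) // -natrX.
rewrite {1}xE lnXn // mulr2n.
have := ltW (ln_sublinear r0).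
have : 2 * Num.sqrt x <= eps * Num.sqrt x * Num.sqrt x by rewrite ler_wpM2r // ltW.
rewrite -mulrA -expr2 -xE; lra.
Qed.

(** The floor plus one, so that it is positive even for [d = 0]. *)
Definition ceil_sqrt (d : nat) : nat := (Num.truncn (Num.sqrt (d%:R : R))).+1.

Lemma ceil_sqrtP d : (d <= ceil_sqrt d ^ 2)%N.
Proof.
have h : Num.sqrt (d%:R : R) < (ceil_sqrt d)%:R by exact: truncnS_gt.
rewrite -(ler_nat R) natrX -[leLHS]sqr_sqrtr ?ler0n //.
by rewrite ler_pXn2r ?nnegrE ?sqrtr_ge0 ?ler0n // ltW.
Qed.

Lemma ceil_sqrt_le d : (ceil_sqrt d)%:R <= Num.sqrt d%:R + 1 :> R.
Proof. by rewrite -natr1 lerD2r truncn_le sqrtr_ge0. Qed.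

Lemma ln_gap_const (s : nat) : (0 < s)%N ->
  ln (4 * gap_const R s * (s ^ 2)%:R) <= 6 + 18 * (s%:R * ln s%:R).
Proof.
move=> s0; have sr0 : 0 < s%:R :> R by rewrite ltr0n.
have s1 : 1 <= s%:R :> R by rewrite ler1n.
have l0 : 0 <= ln (s%:R : R) by rewrite ln_ge0.
have l2 : ln (2 : R) <= 1 by have := @le_ln1Dx R 1; apply; rewrite (lt_trans _ ltr01) // ltrN10.
have -> : 4 * gap_const R s * (s ^ 2)%:R = 2 ^+ 4 * s%:R ^+ (2 * (5 + 4 * s)) * expR 2.
  rewrite /gap_const natrX -exprM.
  have -> : (2 * (5 + 4 * s) = 2 * (4 + 4 * s) + 2)%N by rewrite [RHS]addnC -mulnS.
  by rewrite exprD; move: (s%:R ^+ _) (s%:R ^+ 2) (expR 2) => x y z; ring.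
have p0 : 0 < 2 ^+ 4 :> R by rewrite exprn_gt0.
have q0 : 0 < s%:R ^+ (2 * (5 + 4 * s)) :> R by rewrite exprn_gt0.
have pq0 := mulr_gt0 p0 q0; have e0 := @expR_gt0 R 2.
rewrite lnM ?posrE //. rewrite lnM ?posrE // !lnXn // expRK.
rewrite -[ln s%:R *+ _]mulr_natl natrM natrD natrM.
have : ln s%:R <= s%:R * ln s%:R :> R by rewrite ler_peMl.
by rewrite -[_ *+ 4]mulr_natl => h; clear -l2 h; lra.
Qed.

Variable G : nat -> sgraph.
Hypothesis n_infty : (fun k => order_of (G k)) @ \oo --> \oo.
Hypothesis Delta_small : (fun k => (max_degree (G k))%:R : R) =o_\oo
       (fun k => ln ((order_of (G k))%:R : R) ^+ 2
                 / ln (ln ((order_of (G k))%:R : R)) ^+ 2).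

Let L k : R := ln (order_of (G k))%:R.
Let s k := ceil_sqrt (max_degree (G k)).

Lemma order_near (N : nat) : \forall k \near \oo, (N <= order_of (G k))%N.
Proof. exact: (n_infty (nbhs_infty_ge N)). Qed.

Lemma log_order_near (B : R) : \forall k \near \oo, B <= L k.
Proof.
apply: filterS (order_near (Num.truncn (expR B)).+1) => k hk.
have h : expR B <= (order_of (G k))%:R.
  by apply: le_trans (ltW (truncnS_gt _)) _; rewrite ler_nat.
by rewrite -[B]expRK ler_ln ?posrE ?expR_gt0 // (lt_le_trans (expR_gt0 B)).
Qed.

(** With [r = L / ln L], the degree condition gives [sqrt Delta <= d r]. Since [d r >= 1]
    eventually, rounding up costs a factor 2, so [s <= 2 d r]; with [ln s <= ln L] the product is at
    most [2 d L]. The bound [d <= 1/2] serves to get [s <= L]. *)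
Lemma ceil_sqrt_ln_near (eps : R) : 0 < eps ->
  \forall k \near \oo, (s k)%:R * ln (s k)%:R <= eps * L k.
Proof.
move=> e0; pose d := Num.min (eps / 2) (2^-1).
have d0 : 0 < d by rewrite lt_min divr_gt0 //= invr_gt0.
have de : 2 * d <= eps by rewrite mulrC -ler_pdivlMr // ge_min lexx.
have d1 : 2 * d <= 1 by rewrite mulrC -ler_pdivlMr // ge_min mul1r lexx orbT.
have /eqoP/(_ (d ^+ 2)) := Delta_small; rewrite exprn_gt0 // => /(_ isT) H.
near=> k.
have Lk1 : expR 1 <= L k by near: k; exact: log_order_near.
have Lk2 : 4 / d ^+ 2 <= L k by near: k; exact: log_order_near.
have Dk : `|(max_degree (G k))%:R : R| <= d ^+ 2 * `|L k ^+ 2 / ln (L k) ^+ 2|.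
  by near: k; exact: H.
have L0 : 0 < L k by apply: lt_le_trans Lk1; exact: expR_gt0.
have l1 : 1 <= ln (L k) by rewrite -[1](@expRK R) ler_ln ?posrE ?expR_gt0.
have l0 : 0 < ln (L k) by exact: lt_le_trans l1.
pose r := L k / ln (L k).
have r0 : 0 < r by rewrite divr_gt0.
have dr1 : 1 <= d * r.
  by rewrite /r mulrA ler_pdivlMr // mul1r; exact: ln_le_eps.
have sqrtD : Num.sqrt (max_degree (G k))%:R <= d * r.
  have dr0 : 0 <= d * r by rewrite mulr_ge0 // ltW.
  rewrite -(@ler_pXn2r _ 2) ?nnegrE ?sqrtr_ge0 // sqr_sqrtr ?ler0n //.
  move: Dk; rewrite ger0_norm ?ler0n // ger0_norm ?divr_ge0 ?sqr_ge0 //.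
  by rewrite /r exprMn expr_div_n.
have sk : (s k)%:R <= 2 * d * r.
  by apply: le_trans (ceil_sqrt_le _) _; move: sqrtD dr1; clear; lra.
have s1 : 1 <= (s k)%:R :> R by rewrite ler1n.
have sr : (s k)%:R <= L k.
  apply: le_trans sk _; apply: (@le_trans _ _ (1 * r)).
    by rewrite ler_wpM2r // ltW.
  by rewrite mul1r /r ler_pdivrMr // ler_peMr // ltW.
have lns : ln (s k)%:R <= ln (L k).
  by rewrite ler_ln ?posrE // (lt_le_trans ltr01).
apply: (@le_trans _ _ (2 * d * r * ln (L k))).
  by apply: ler_pM => //; rewrite ?ln_ge0 // (le_trans ler01).
rewrite -mulrA /r divfK ?gt_eqF // ler_wpM2r // ltW.
Unshelve. all: by end_near. Qed.

Lemma ln_gap_near (eps : R) : 0 < eps ->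
  \forall k \near \oo, ln (4 * gap_const R (s k) * (s k ^ 2)%:R) <= eps * L k.
Proof.
move=> e0; near=> k.
apply: le_trans (ln_gap_const (isT : (0 < s k)%N)) _.
have h1 : (s k)%:R * ln (s k)%:R <= eps / 36 * L k.
  by near: k; apply: ceil_sqrt_ln_near; rewrite divr_gt0.
have h2 : 12 / eps <= L k by near: k; exact: log_order_near.
move: h2; rewrite ler_pdivrMr // => h2.
move: h1 h2; clear; lra.
Unshelve. all: by end_near. Qed.

End Asymptotics.

(** * The two mixing bounds *)

Lemma poly_le_power (R : realType) (p : {poly R}) :
  exists A : R, 1 <= A /\ forall x : R, 1 <= x -> p.[x] <= A * x ^+ size p.
Proof.
exists (\sum_(i < size p) `|p`_i| + 1); split; first by rewrite lerDr sumr_ge0.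
move=> x x1; have x0 : 0 <= x by exact: le_trans x1.
rewrite horner_coef mulrDl mul1r mulr_suml.
apply: (@le_trans _ _ (\sum_(i < size p) `|p`_i| * x ^+ size p)).
  apply: ler_sum => i _; apply: le_trans (ler_norm _) _.
  rewrite normrM ler_wpM2l // ger0_norm ?exprn_ge0 //.
  by rewrite ler_weXn2l // ltnW.
by rewrite lerDl exprn_ge0.
Qed.

Lemma powR_1D (R : realType) (x y : R) : 0 < x -> x `^ (1 + y) = x * expR (y * ln x).
Proof.
move=> x0; have xn0 : x != 0 by rewrite gt_eqF.
rewrite powRD ?xn0 ?implybT // powRr1 ?(ltW x0) //.
by rewrite /powR (negPf xn0).
Qed.

Theorem theorem1p4 (R : realType) (G : nat -> sgraph)
    (n_infty : (fun k => order_of (G k)) @ \oo --> \oo)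
    (Delta_small : (fun k => (max_degree (G k))%:R : R) =o_\oo
       (fun k => ln ((order_of (G k))%:R : R) ^+ 2
                 / ln (ln ((order_of (G k))%:R : R)) ^+ 2)) :
  (exists (eps : nat -> R) (C : R),
     eps @ \oo --> (0 : R) /\
     \forall k \near \oo,
       (worst_mixing_time R (G k) <=
         (C * ((order_of (G k))%:R `^ (1 + eps k) * (size_of (G k))%:R))%:E)%E)
  /\
  (forall pi : forall k, matching (G k) -> R,
     warm_starts pi ->
     (exists K : nat, \forall k \near \oo,
        (order_of (G k) <= size_of (G k) ^ K)%N) ->
     exists (eps : nat -> R) (C : R),
       eps @ \oo --> (0 : R) /\
       \forall k \near \oo,
         (mixing_time (pi k) <= (C * (size_of (G k))%:R `^ (1 + eps k))%:E)%E).
Proof.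
pose s k := ceil_sqrt R (max_degree (G k)).
pose L k : R := ln (order_of (G k))%:R.
pose g k := gap_const R (s k).
have s0 k : (0 < s k)%N by [].
have degs k : (max_degree (G k) <= s k ^ 2)%N by exact: ceil_sqrtP.
have g1 k : 1 <= g k by exact: gap_const_ge1.
have L_near := @log_order_near R G n_infty.
have gap_near := ln_gap_near n_infty Delta_small.
have s21 k : 1 <= (s k ^ 2)%:R :> R by rewrite ler1n expn_gt0 s0.
have X1 k : g k <= 4 * g k * (s k ^ 2)%:R.
  have g0 : 0 <= g k by exact: le_trans (g1 k).
  by have := ler_wpM2l g0 (s21 k); rewrite mulr1; move: (g1 k); clear; lra.
split.
  (* Chosen so that [n^eps] equals the prefactor in [worst_mixing_time_le]. *)
  pose eps k := ln (4 * g k * (s k ^ 2)%:R) / L k.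
  exists eps, 1; split.
    apply/cvgr0Pnorm_le => e e0; near=> k.
    have Lk1 : 1 <= L k by near: k; exact: L_near.
    have Lk0 : 0 < L k by exact: lt_le_trans Lk1.
    rewrite ger0_norm; last first.
      by rewrite divr_ge0 ?(ltW Lk0) // ln_ge0 // (le_trans _ (X1 k)).
    by rewrite ler_pdivrMr //; near: k; exact: gap_near.
  near=> k.
  have Lk1 : 1 <= L k by near: k; exact: L_near.
  have Lk0 : 0 < L k by exact: lt_le_trans Lk1.
  have n0 : 0 < (order_of (G k))%:R :> R.
    by rewrite ltr0n; near: k; exact: (order_near n_infty 1).
  apply: le_trans (worst_mixing_time_le R (s0 k) (degs k)) _.
  have Xp : 0 < 4 * g k * (s k ^ 2)%:R.
    by apply: lt_le_trans (X1 k); exact: lt_le_trans (g1 k).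
  rewrite powR_1D // -/(L k) divfK ?gt_eqF // lnK ?posrE // mul1r lee_fin.
  by rewrite -/(g k) [(order_of (G k))%:R * _]mulrC.
move=> pi [dpi [p warm]] [K nK].
pose c k := p.[(order_of (G k))%:R].
pose W k := g k * ln (4 * c k) + 1.
(* [W] is [n^o(1)], but the bound is in terms of [m]. As [L <= K * ln m], this exponent gives
   [m^eps >= W]. *)
pose eps k := K%:R * ln (W k) / L k.
have [A [A1 pA]] := poly_le_power p.
have m_near : \forall k \near \oo, (0 < size_of (G k))%N.
  near=> k; rewrite lt0n; apply/eqP => m0.
  have h1 : (order_of (G k) <= size_of (G k) ^ K)%N by near: k; exact: nK.
  have h2 : (2 <= order_of (G k))%N by near: k; exact: (order_near n_infty 2).
  by have := leq_trans h2 h1; rewrite m0; case: (K) => [|j]; rewrite ?expn0 ?exp0n.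
have warm_near : \forall k \near \oo, 1 <= c k /\
  (mixing_time (pi k) <= (g k * (size_of (G k))%:R * ln (4 * c k) + 1)%:E)%E.
  by apply: filterS m_near => k m0; apply: warm_mixing_time_le => // M; exact: warm.
have W_near (e : R) : 0 < e -> \forall k \near \oo, 0 <= ln (W k) <= e * L k.
  (* [ln (4 * c k)] is at most [size p * L k] plus a constant, which one more [L k] absorbs. *)
  move=> e0; pose d : R := (size p)%:R + 1.
  have d0 : 0 < d by rewrite ltr_wpDl.
  near=> k.
  have [c1 _] : 1 <= c k /\
    (mixing_time (pi k) <= (g k * (size_of (G k))%:R * ln (4 * c k) + 1)%:E)%E.
    by near: k; exact: warm_near.
  have Lk1 : 1 <= L k by near: k; exact: L_near.
  have LkA : ln (4 * A) + 1 <= L k by near: k; exact: L_near.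
  have Lke : 4 / (e / (2 * d)) ^+ 2 <= d * L k.
    by rewrite [d * _]mulrC -ler_pdivrMr //; near: k; exact: L_near.
  have Lk0 : 0 < L k by exact: lt_le_trans Lk1.
  have gk : ln (4 * g k * (s k ^ 2)%:R) <= e / 2 * L k.
    by near: k; apply: gap_near; rewrite divr_gt0.
  have n1 : 1 <= (order_of (G k))%:R :> R.
    by rewrite ler1n; near: k; exact: (order_near n_infty 1).
  have n0 : 0 < (order_of (G k))%:R :> R by exact: lt_le_trans n1.
  have c0 : 0 < c k by exact: lt_le_trans c1.
  have A0 : 0 < A by exact: lt_le_trans A1.
  have c41 : 1 <= 4 * c k by move: c1; clear; lra.
  have lc0 : 0 <= ln (4 * c k) by exact: ln_ge0.
  have lc : ln (4 * c k) + 1 <= d * L k.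
    have : ln (4 * c k) <= ln (4 * A * (order_of (G k))%:R ^+ size p).
      have q0 : 0 < (order_of (G k))%:R ^+ size p :> R by rewrite exprn_gt0.
      rewrite ler_ln ?posrE ?mulr_gt0 // -mulrA ler_pM2l //; exact: pA.
    rewrite lnM ?posrE ?exprn_gt0 ?mulr_gt0 // lnXn // -[_ *+ size p]mulr_natl -/(L k).
    by rewrite /d mulrDl mul1r; move: LkA => h1 h2; move: h1 h2; clear; lra.
  have gk0 : 0 < g k by exact: lt_le_trans (g1 k).
  have W1 : 1 <= W k by rewrite lerDr mulr_ge0 // ltW.
  apply/andP; split; first exact: ln_ge0.
  have WE : W k <= g k * (d * L k).
    apply: (@le_trans _ _ (g k * (ln (4 * c k) + 1))); last by rewrite ler_pM2l.
    by rewrite mulrDr mulr1 lerD2l.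
  have dL0 : 0 < d * L k by rewrite mulr_gt0.
  have : ln (W k) <= ln (g k * (d * L k)).
    have W0 : 0 < W k by exact: lt_le_trans W1.
    have gdL0 : 0 < g k * (d * L k) by rewrite mulr_gt0.
    by rewrite ler_ln ?posrE.
  rewrite lnM ?posrE //.
  have h1 : ln (g k) <= e / 2 * L k.
    apply: le_trans gk; rewrite ler_ln ?posrE //.
    exact: lt_le_trans (X1 k).
  have h2 : ln (d * L k) <= e / 2 * L k.
    have e2d : 0 < e / (2 * d) by rewrite divr_gt0 ?mulr_gt0.
    apply: le_trans (ln_le_eps e2d Lke) _.
    by rewrite le_eqVlt; apply/orP; left; apply/eqP; field; rewrite gt_eqF.
  by move=> h3; move: h1 h2 h3; clear; lra.
exists eps, 1; split.
  apply/cvgr0Pnorm_le => e e0; near=> k.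
  have Lk1 : 1 <= L k by near: k; exact: L_near.
  have Lk0 : 0 < L k by exact: lt_le_trans Lk1.
  (* [K + 1] rather than [K], which may be 0. *)
  have /andP[w0 w1] : 0 <= ln (W k) <= e / (K%:R + 1) * L k.
    by near: k; apply: W_near; rewrite divr_gt0 ?ltr_wpDl.
  rewrite /eps ger0_norm; last by rewrite divr_ge0 ?mulr_ge0 ?(ltW Lk0).
  rewrite ler_pdivrMr //.
  apply: (@le_trans _ _ ((K%:R + 1) * (e / (K%:R + 1) * L k))).
    by apply: ler_pM => //; rewrite lerDl.
  by rewrite mulrA mulrCA divff ?mulr1 // gt_eqF // ltr_wpDl.
near=> k.
have Lk1 : 1 <= L k by near: k; exact: L_near.
have Lk0 : 0 < L k by exact: lt_le_trans Lk1.
have m0 : (0 < size_of (G k))%N by near: k; exact: m_near.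
have mr0 : 0 < (size_of (G k))%:R :> R by rewrite ltr0n.
have mr1 : 1 <= (size_of (G k))%:R :> R by rewrite ler1n.
have [c1 mix] : 1 <= c k /\
  (mixing_time (pi k) <= (g k * (size_of (G k))%:R * ln (4 * c k) + 1)%:E)%E.
  by near: k; exact: warm_near.
have /andP[w0 _] : 0 <= ln (W k) <= 1 * L k by near: k; exact: W_near.
have n0 : 0 < (order_of (G k))%:R :> R.
  by rewrite ltr0n; near: k; exact: (order_near n_infty 1).
have LK : L k <= K%:R * ln (size_of (G k))%:R.
  rewrite mulr_natl -lnXn // /L ler_ln ?posrE ?exprn_gt0 // -natrX ler_nat.
  by near: k; exact: nK.
have W0 : 0 < W k.
  have c41 : 1 <= 4 * c k by move: c1; clear; lra.
  by rewrite ltr_wpDl // mulr_ge0 ?ln_ge0 // (le_trans _ (g1 k)).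
apply: le_trans mix _; rewrite lee_fin mul1r powR_1D //.
apply: (@le_trans _ _ ((size_of (G k))%:R * W k)).
  rewrite /W mulrDr mulr1 mulrA [_ * g k]mulrC lerD2l.
  exact: mr1.
rewrite ler_pM2l // -[leLHS](lnK (_ : W k \in Num.pos)) ?posrE // ler_expR.
have -> : eps k * ln (size_of (G k))%:R =
    ln (W k) * (K%:R * ln (size_of (G k))%:R / L k).
  by rewrite /eps; field; rewrite gt_eqF.
by rewrite ler_peMr // ler_pdivlMr // mul1r.
Unshelve. all: by end_near. Qed.
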